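(* Fix $0<c<1$ and let $k$ be a sufficiently large integer. Let $m,M\in\mathbb{Z}_+$ with $M=3m^{5/4}$. Let $0<\epsilon<1/2$ and let $\delta$ be a sufficiently small multiple of $\epsilon\sqrt{\log(1/\epsilon)}/k^2$. Let $\tau=\Theta(M^{-(k+1)/5}\delta)$. Assume that $m>\max\big(C'/\epsilon,\, k^2/\log(1/\delta)\big)$ for some sufficiently large constant $C'>0$. Then any SQ algorithm which is given access to a distribution $\mathbf{P}$ over $\{0,1\}^M$ satisfying $d_{\mathrm{TV}}\big(\mathbf{P},U_M^{S,\delta/\sqrt{m}}\big)\le\epsilon$ for some unknown subset $S\subseteq[M]$ with $|S|=m$, and which outputs an estimate $\widehat{\mu}$ with $\big\|\widehat{\mu}-\mu_M^{S,\delta/\sqrt{m}}\big\|_2\le O(\delta)$ with probability at least $2/3$, must either make queries of accuracy better than $\sqrt{2\tau}$ or must make at least $2^{\Omega(M^{2/5})}M^{-(k+1)/5}$ statistical queries.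
   Context: For $0\le\delta'\le 1/2$ and $S\subseteq[M]$ with $|S|=m$, $U_M^{S,\delta'}$ is the product distribution on $\{0,1\}^M$ in which coordinate $i$ has mean $1/2+\delta'$ if $i\in S$ and mean $1/2$ otherwise, and $\mu_M^{S,\delta'}\in\mathbb{R}^M$ is its mean vector. $d_{\mathrm{TV}}$ denotes total variation distance. An SQ algorithm accesses the unknown distribution $D$ only through a $\mathrm{STAT}(\tau')$ oracle: given a query $f:\{0,1\}^M\to[-1,1]$, the oracle returns some $v$ with $|v-\mathbf{E}_{X\sim D}[f(X)]|\le\tau'$ ($\tau'$ is the tolerance/accuracy). ''Queries of accuracy better than $\sqrt{2\tau}$'' means queries of tolerance smaller than $\sqrt{2\tau}$. The $\Omega$ hides an absolute constant.
   Formalization: The constant hidden in the error bound O(δ) is taken to be any number in (0,1); for a constant ≥ 1 the claim fails, since the estimate (1/2,…,1/2) has error exactly δ and needs no queries. *)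

(* Defs.v *)
From mathcomp Require Import all_boot all_order all_algebra.
From mathcomp Require Import all_classical all_reals all_analysis.

Set Implicit Arguments.
Unset Strict Implicit.
Unset Printing Implicit Defensive.

Import Order.TTheory GRing.Theory Num.Theory.
Local Open Scope classical_set_scope.
Local Open Scope ring_scope.

(* {0,1}^M; [true] stands for 1. *)
Definition cube (M : nat) := {ffun 'I_M -> bool}.

(* Distributions over the finite set {0,1}^M are probability mass functions. *)
Definition is_pmf (R : realType) (M : nat) (P : cube M -> R) : Prop :=
  (forall x, 0 <= P x) /\ \sum_x P x = 1.

Definition expect (R : realType) (M : nat) (P f : cube M -> R) : R :=
  \sum_x P x * f x.

Definition mean_vec (R : realType) (M : nat) (P : cube M -> R) : 'rV[R]_M :=
  \row_i expect P (fun x => (x i)%:R).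

Definition dTV (R : realType) (M : nat) (P Q : cube M -> R) : R :=
  2^-1 * \sum_x `|P x - Q x|.

Definition l2norm (R : realType) (M : nat) (v : 'rV[R]_M) : R :=
  Num.sqrt (\sum_i v 0 i ^+ 2).

(* U_M^{S,d}: independent coordinates, of mean 1/2 + d on S and 1/2 off S.
   It is a distribution only for 0 <= d <= 1/2. *)
Definition Uprod (R : realType) (M : nat) (S : {set 'I_M}) (d : R)
    (x : cube M) : R :=
  \prod_(i < M)
    let p := if i \in S then 2^-1 + d else 2^-1 in
    if x i then p else 1 - p.

(* The tolerance may vary from one query to the next. *)
Record sq_query (R : realType) (M : nat) := SQQuery {
  qfun : cube M -> R;
  tol : R;
  qfun_bounded : forall x, -1 <= qfun x <= 1;
  tol_gt0 : 0 < tol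
}.

(* A deterministic adaptive algorithm, as a well-founded decision tree: the
   continuation of [SQAsk] receives the answer of the oracle. *)
Inductive sq_alg (R : realType) (M : nat) : Type :=
| SQReturn of 'rV[R]_M
| SQAsk of sq_query R M & (R -> sq_alg R M).

(* Answers depend on the query only. Asking an algorithm to succeed against
   these oracles is weaker than asking it to succeed against oracles that also
   see the history, so a lower bound proved here covers both. *)
Definition oracle (R : realType) (M : nat) := sq_query R M -> R.

Definition stat_oracle (R : realType) (M : nat) (P : cube M -> R)
    (O : oracle R M) : Prop :=
  forall q, `|O q - expect P (qfun q)| <= tol q.

Fixpoint sq_output (R : realType) (M : nat) (A : sq_alg R M)
    (O : oracle R M) : 'rV[R]_M :=
  match A with
  | SQReturn v => v
  | SQAsk q next => sq_output (next (O q)) O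
  end.

Fixpoint sq_queries (R : realType) (M : nat) (A : sq_alg R M)
    (O : oracle R M) : seq (sq_query R M) :=
  match A with
  | SQReturn _ => [::]
  | SQAsk q next => q :: sq_queries (next (O q)) O
  end.

(* O answers queries about some distribution P within eps of U_M^{S,d},
   with |S| = m. *)
Definition instance (R : realType) (m M : nat) (eps d : R) (S : {set 'I_M})
    (O : oracle R M) : Prop :=
  #|S| = m /\
  exists P : cube M -> R,
    [/\ is_pmf P, dTV P (Uprod S d) <= eps & stat_oracle P O].

(* "The event B has probability at least p". Nothing forces the success event
   of an algorithm to be measurable, whence the inner probability; for
   measurable B this is p <= Pr B. *)
Definition prob_ge (R : realType) (d : measure_display) (W : measurableType d)
    (Pr : probability W R) (B : set W) (p : R) : Prop :=
  exists E : set W, [/\ measurable E, E `<=` B & (p%:E <= Pr E)%E].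

(* A randomized algorithm is a family of deterministic ones indexed by the
   internal randomness w, drawn from Pr independently of the oracle. *)
Definition sq_estimates (R : realType) (m M : nat) (eps d err : R)
    (disp : measure_display) (W : measurableType disp) (Pr : probability W R)
    (A : W -> sq_alg R M) : Prop :=
  forall (S : {set 'I_M}) (O : oracle R M), instance m eps d S O ->
    prob_ge Pr
      [set w | l2norm (sq_output (A w) O - mean_vec (Uprod S d)) <= err]
      (2 / 3).

(* The cost of an algorithm is its worst case over the internal randomness and
   over the admissible oracles. *)
Definition sq_run (R : realType) (m M : nat) (eps d : R) (W : Type)
    (A : W -> sq_alg R M) (s : seq (sq_query R M)) : Prop :=
  exists (w : W) (S : {set 'I_M}) (O : oracle R M),
    instance m eps d S O /\ s = sq_queries (A w) O.

Definition uses_tol_below (R : realType) (m M : nat) (eps d : R) (W : Type)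
    (A : W -> sq_alg R M) (t : R) : Prop :=
  exists s, sq_run m eps d A s /\ has (fun q => tol q < t) s.

Definition uses_queries_at_least (R : realType) (m M : nat) (eps d : R)
    (W : Type) (A : W -> sq_alg R M) (N : R) : Prop :=
  exists s, sq_run m eps d A s /\ N <= (size s)%:R.

(* Main.v *)
Require Import Defs.
From mathcomp Require Import all_boot all_order all_algebra.
From mathcomp Require Import qpoly.
From mathcomp Require Import all_classical all_reals all_analysis.
From mathcomp Require Import measurable_realfun.
From mathcomp Require Import ring lra zify.

(** Write P_S = 2^-M (1 + f_S), where f_S is a signed mixture of tilted product
    measures whose parameters are d = delta / sqrt m and the negative nodes
    - D j^2 / K^2 (0 <= j <= K, K odd), with D of order sqrt (ln (1/eps) / m).
    Taking for the coefficients minus the Lagrange basis polynomials of the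
    nodes evaluated at d makes the moments of order <= K of the mixture vanish,
    so two such f_S, f_S' have correlation
    sum_(i > K) C(n, i) 4^i alpha_i^2 with n = #|S :&: S'|, of order
    (n / m)^(K+1).  Square nodes keep the Lagrange coefficients
    O(delta K^2 / sqrt (ln (1/eps))), whence dTV (P_S, U_S) <= eps.  All nodes
    being <= 0, the positive part of P_S dominates on both tails once the
    coefficient at the extreme node - D has the right sign, that is for K odd.
    When 2 delta <= eps none of this is needed: the uniform distribution itself
    is eps-close to every U_S.

    Sets S are graphs of functions from m rows to about M/m columns; two random
    graphs overlap in at least r >= 4 m^(3/4) points with probability at most
    2^-r.  An oracle that answers as under the uniform distribution whenever the
    tolerance permits thus reveals nothing about most S, and a fixed vector is a
    good estimate for few S only. *)

Set Implicit Arguments.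
Unset Strict Implicit.
Unset Printing Implicit Defensive.

Import Order.TTheory GRing.Theory Num.Theory.
Local Open Scope ring_scope.

(** * Tilted product measures on the cube *)

Definition unif (R : realType) (M : nat) : cube M -> R := fun=> 2^-M.

Definition avg (R : realType) (M : nat) (g : cube M -> R) : R :=
  expect (@unif R M) g.

(** The density of [Uprod S e] with respect to the uniform distribution; the mixtures below also
    take negative [e]. *)
Definition tilt (R : realType) (M : nat) (S : {set 'I_M}) (e : R)
    (x : cube M) : R :=
  \prod_(i < M) (if i \in S then if x i then 1 + 2 * e else 1 - 2 * e else 1).

Section Cube.
Variables (R : realType) (M : nat).
Implicit Types (S : {set 'I_M}) (e : R) (x : cube M) (f g : cube M -> R).

Lemma sum_cube_prod (F : 'I_M -> bool -> R) :
  \sum_(x : cube M) \prod_i F i (x i) = \prod_i (F i true + F i false).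
Proof.
rewrite -(bigA_distr_bigA F); apply: eq_bigr => i _.
by rewrite big_bool.
Qed.

Lemma avg_prod (F : 'I_M -> bool -> R) :
  avg (fun x => \prod_i F i (x i)) = \prod_i ((F i true + F i false) / 2).
Proof.
rewrite /avg /expect /unif -mulr_sumr sum_cube_prod big_split /= mulrC.
by rewrite prodr_const card_ord exprVn.
Qed.

Lemma UprodE S e x : Uprod S e x = 2^-M * tilt S e x.
Proof.
rewrite /Uprod /tilt -exprVn -[X in _ ^+ X](card_ord M) -prodr_const -big_split /=.
apply: eq_bigr => i _.
by case: ifP => _; case: ifP => _; lra.
Qed.

Lemma tilt0 S x : tilt S 0 x = 1 :> R.
Proof.
by rewrite /tilt big1 // => i _; case: ifP => // _; case: ifP => _; lra.
Qed.

Lemma avg_sum (I : Type) (r : seq I) (F : I -> cube M -> R) :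
  avg (fun x => \sum_(i <- r) F i x) = \sum_(i <- r) avg (F i).
Proof.
rewrite /avg /expect exchange_big /=.
by apply: eq_bigr => x _; rewrite mulr_sumr.
Qed.

Lemma avgZ (c : R) f : avg (fun x => c * f x) = c * avg f.
Proof.
by rewrite /avg /expect mulr_sumr; apply: eq_bigr => x _; rewrite mulrCA.
Qed.

Lemma avgD f g : avg (fun x => f x + g x) = avg f + avg g.
Proof.
by rewrite /avg /expect -big_split; apply: eq_bigr => x _; rewrite mulrDr.
Qed.

Lemma le_avg f g : (forall x, f x <= g x) -> avg f <= avg g.
Proof.
move=> fg; apply: ler_sum => x _; apply: ler_wpM2l; last exact: fg.
by rewrite /unif invr_ge0 exprn_ge0.
Qed.

Lemma eq_avg f g : f =1 g -> avg f = avg g.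
Proof. by move=> fg; apply: eq_bigr => x _; rewrite fg. Qed.

Arguments eq_avg f g : clear implicits.

Lemma avg_cst (c : R) : @avg R M (fun=> c) = c.
Proof.
rewrite /avg /expect -mulr_suml /unif sumr_const card_ffun card_bool card_ord.
by rewrite -(mulr_natl (2 ^- M)) natrX mulfV ?mul1r // expf_neq0.
Qed.

Lemma unif_pmf : is_pmf (@unif R M).
Proof.
split=> [x|]; first by rewrite /unif invr_ge0 exprn_ge0.
by rewrite -[RHS](avg_cst 1); apply: eq_bigr => x _; rewrite mulr1.
Qed.

Lemma avg_sqr_le f : avg f ^+ 2 <= avg (fun x => f x ^+ 2).
Proof.
have : 0 <= avg (fun x => (f x - avg f) ^+ 2).
  by rewrite -[leLHS](avg_cst 0); apply: le_avg => x; exact: sqr_ge0.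
rewrite (eq_avg (fun x => (f x - avg f) ^+ 2)
  (fun x => (f x ^+ 2 + (- 2 * avg f) * f x) + avg f ^+ 2)).
  by rewrite avgD avgD avgZ avg_cst; nra.
by move=> x; ring.
Qed.

(** Coordinates are independent under the uniform distribution: one lying in both sets contributes
    [1 + 4 * e * e'], any other contributes 1. *)
Lemma avg_tilt2 (S S' : {set 'I_M}) (e e' : R) :
  avg (fun x => tilt S e x * tilt S' e' x) = (1 + 4 * e * e') ^+ #|S :&: S'|.
Proof.
pose F (i : 'I_M) (b : bool) : R :=
  (if i \in S then if b then 1 + 2 * e else 1 - 2 * e else 1) *
  (if i \in S' then if b then 1 + 2 * e' else 1 - 2 * e' else 1).
rewrite (eq_avg _ (fun x => \prod_i F i (x i))); last first.
  by move=> x; rewrite /tilt -big_split.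
rewrite avg_prod -prodr_const [RHS]big_mkcond /=.
apply: eq_bigr => i _; rewrite /F inE.
by case: (i \in S); case: (i \in S') => /=; lra.
Qed.

Lemma avg_tilt S e : avg (tilt S e) = 1 :> R.
Proof.
rewrite (eq_avg _ (fun x => tilt S e x * tilt S 0 x)).
  by rewrite avg_tilt2 mulr0 addr0 expr1n.
by move=> x; rewrite tilt0 mulr1.
Qed.

Lemma mean_vec_Uprod S e i :
  mean_vec (Uprod S e) 0 i = 2^-1 + (if i \in S then e else 0).
Proof.
rewrite mxE.
pose F (j : 'I_M) (b : bool) : R :=
  (if j \in S then if b then 1 + 2 * e else 1 - 2 * e else 1) *
  (if j == i then b%:R else 1).
transitivity (avg (fun x => \prod_j F j (x j))).
  apply: eq_bigr => x _; rewrite UprodE /unif -mulrA; congr (_ * _).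
  rewrite big_split /=; congr (_ * _).
  by rewrite (bigD1 i) //= eqxx big1 ?mulr1 // => j /negbTE ->.
rewrite avg_prod (bigD1 i) //= big1 => [|j /negbTE ji].
  by rewrite /F eqxx /=; case: ifP => _; lra.
by rewrite /F ji; case: ifP => _; lra.
Qed.

Lemma dTV_avgE (f : cube M -> R) S e :
  dTV (fun x => 2^-M * f x) (Uprod S e) =
  2^-1 * avg (fun x => `|f x - tilt S e x|).
Proof.
rewrite /dTV; congr (_ * _); apply: eq_bigr => x _.
by rewrite UprodE -mulrBr normrM ger0_norm // invr_ge0 exprn_ge0.
Qed.

(** The pairwise-correlation bound on what one query can detect. If [q] detects [n] functions, then
    [(n t)^2 <= n (n tau + p |I| chi)]: pairs outside [bad] cost [tau], bad ones cost [chi] more and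
    are counted by [p]. Since [t^2 >= 2 tau], the term [n tau] is absorbed on the left. *)
Lemma correlated_avg_le (I : finType) (f : I -> cube M -> R)
    (bad : rel I) (gam chi p tau t : R) (q : cube M -> R) :
  0 <= chi -> 0 <= tau -> gam <= tau -> 2 * tau <= t ^+ 2 -> 0 <= t ->
  (forall i j, ~~ bad i j -> `|avg (fun x => f i x * f j x)| <= gam) ->
  (forall i j, `|avg (fun x => f i x * f j x)| <= chi) ->
  (forall i, #|[pred j | bad i j]|%:R <= p * #|I|%:R) ->
  (forall x, -1 <= q x <= 1) ->
  #|[pred i | t < `|avg (fun x => q x * f i x)|]|%:R * tau
    <= p * #|I|%:R * chi.
Proof.
move=> chi0 tau0 gt tt t0 Hgam Hchi Hbad Hq.
set D := [pred i | _]; set n : R := #|D|%:R.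
have [D0|Dn0] := posnP #|D|.
  have [i|I0] := pickP I; last first.
    by rewrite /n D0 (eq_card0 I0) mulr0 !mul0r.
  rewrite /n D0 mul0r mulr_ge0 //.
  exact: le_trans (Hbad i).
have n0 : 0 < n by rewrite ltr0n.
(* Cauchy-Schwarz against the signed sum of the [f i] that [q] detects *)
pose s i := Num.sg (avg (fun x => q x * f i x)).
pose g x := \sum_(i in D) s i * f i x.
have H1 : n * t <= avg (fun x => q x * g x).
  rewrite (eq_avg _ (fun x => \sum_(i in D) s i * (q x * f i x))); last first.
    by move=> x; rewrite /g mulr_sumr; apply: eq_bigr => i _; rewrite mulrCA.
  rewrite /avg /expect; under eq_bigr do rewrite mulr_sumr.
  rewrite exchange_big /= /n -sum1_card natr_sum mulr_suml.
  apply: ler_sum => i; rewrite inE => /ltW iD; rewrite mul1r (le_trans iD) //.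
  rewrite normrEsg -/(s i) -avgZ; apply: ler_sum => x _ //.
have H2 : (avg (fun x => q x * g x)) ^+ 2 <= avg (fun x => g x ^+ 2).
  apply: le_trans (avg_sqr_le _) _; apply: le_avg => x.
  rewrite exprMn -[leRHS]mul1r; apply: ler_wpM2r; first exact: sqr_ge0.
  have /andP[q1 q2] := Hq x; nra.
have H3 : avg (fun x => g x ^+ 2) <=
    \sum_(i in D) \sum_(j in D) `|avg (fun x => f i x * f j x)|.
  rewrite (eq_avg _ (fun x => \sum_(i in D) \sum_(j in D)
      (s i * s j) * (f i x * f j x))); last first.
    move=> x; rewrite expr2 /g mulr_suml; apply: eq_bigr => i _.
    by rewrite mulr_sumr; apply: eq_bigr => j _; rewrite mulrACA.
  rewrite /avg /expect; under eq_bigr do rewrite mulr_sumr.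
  rewrite exchange_big /=; apply: ler_sum => i _.
  under eq_bigr do rewrite mulr_sumr.
  rewrite exchange_big /=; apply: ler_sum => j _.
  rewrite -[leLHS]/(avg (fun x => (s i * s j) * (f i x * f j x))) avgZ.
  apply: le_trans (ler_norm _) _; rewrite normrM -[leRHS]mul1r.
  apply: ler_wpM2r => //; rewrite /s normrM !normr_sg.
  by case: (_ != 0); case: (_ != 0) => /=; lra.
have p0 : 0 <= p * #|I|%:R * chi.
  have /card_gt0P[i _] := Dn0.
  by apply: mulr_ge0 => //; exact: le_trans (Hbad i).
have H4 i : \sum_(j in D) `|avg (fun x => f i x * f j x)| <=
    n * tau + p * #|I|%:R * chi.
  apply: (@le_trans _ _ (\sum_(j in D) (tau + (bad i j)%:R * chi))).
    apply: ler_sum => j _; case: (boolP (bad i j)) => [_|/Hgam].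
      by rewrite mul1r (le_trans (Hchi i j)) // lerDr.
    by rewrite mul0r addr0 => /le_trans; apply.
  rewrite big_split /= sumr_const -(mulr_natl tau) -/n lerD2l -mulr_suml.
  apply: ler_wpM2r => //; apply: le_trans (Hbad i).
  rewrite -sum1_card natr_sum big_mkcond [leRHS]big_mkcond /=.
  apply: ler_sum => j _; rewrite (_ : (j \in [pred j | bad i j]) = bad i j) //.
  by case: (j \in D); case: (bad i j).
have H5 : (n * t) ^+ 2 <= n * (n * tau + p * #|I|%:R * chi).
  apply: (@le_trans _ _ (avg (fun x => q x * g x) ^+ 2)).
    by rewrite ler_sqr // nnegrE ?(le_trans _ H1) // mulr_ge0 // ltW.
  apply: le_trans H2 _; apply: le_trans H3 _.
  apply: le_trans (ler_sum _ (fun i _ => H4 i)) _.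
  by rewrite sumr_const -(mulr_natl (_ + _)).
have H6 : n * t ^+ 2 <= n * tau + p * #|I|%:R * chi.
  by rewrite -(ler_pM2l n0) mulrA -expr2 -exprMn.
have H7 : n * (2 * tau) <= n * t ^+ 2 by rewrite ler_pM2l.
lra.
Qed.

End Cube.

Arguments eq_avg {R M} f g.

(** * Statistical queries *)

(** The sum of the probabilities is the integral of the number of events that contain [w]. *)
Lemma sum_probability_le (R : realType) (d : measure_display)
    (W : measurableType d) (Pr : probability W R) (I : finType)
    (E : I -> set W) (c : R) :
  (forall i, measurable (E i)) ->
  (forall w, \sum_i \1_(E i) w <= c) ->
  (\sum_i Pr (E i) <= c%:E)%E.
Proof.
move=> mE Ec.
have mI i : measurable_fun setT (fun w : W => (\1_(E i) w : R)).
  exact: measurable_indic.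
have -> : (\sum_i Pr (E i) = \int[Pr]_w (\sum_i \1_(E i) w)%:E)%E.
  under eq_integral do rewrite -sumEFin.
  rewrite ge0_integral_sum //.
  - by apply: eq_bigr => i _; rewrite integral_indic // setIT.
  - by move=> i; apply/measurable_EFinP.
have -> : (c%:E = \int[Pr]_w (cst c%:E) w)%E.
  by rewrite integral_cst // [X in (_ * X)%E]probability_setT mule1.
apply: ge0_le_integral => //.
- by move=> w _; rewrite lee_fin sumr_ge0.
- apply/measurable_EFinP. apply: measurable_sum => i.
  by apply: measurable_indic.
- by move=> w _; rewrite lee_fin.
Qed.

Section SQ.
Variables (R : realType) (M : nat).
Implicit Types (A : sq_alg R M) (O : oracle R M) (q : sq_query R M).

(** The next query depends only on the answers so far, so [n] common answers fix [n + 1] queries.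
    The extra query drives the induction in [sq_lower_bound]. *)
Lemma sq_queries_agree A O O' n :
  all (fun q => O q == O' q) (take n (sq_queries A O')) ->
  take n.+1 (sq_queries A O) = take n.+1 (sq_queries A O').
Proof.
elim: A n => [//|q next IH] [|n] /=; first by rewrite !take0.
by case/andP => /eqP -> /IH ->.
Qed.

Lemma sq_output_agree A O O' :
  all (fun q => O q == O' q) (sq_queries A O') ->
  sq_output A O = sq_output A O'.
Proof. by elim: A => [//|q next IH] /= /andP[/eqP -> /IH]. Qed.

(** The adversary: it betrays [P] only on queries whose tolerance is smaller than the shift from the
    uniform expectation. *)
Definition lazy_oracle (P : cube M -> R) : oracle R M := fun q =>
  if `|avg (qfun q) - expect P (qfun q)| <= tol q then avg (qfun q)
  else expect P (qfun q).

Lemma lazy_oracleP (P : cube M -> R) : stat_oracle P (lazy_oracle P).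
Proof.
by move=> q; rewrite /lazy_oracle; case: ifP => // _; rewrite subrr normr0 ltW ?tol_gt0.
Qed.

(** Union bound over the queries in [s]. *)
Lemma card_not_all (I : finType) (Q : Type) (P : I -> pred Q) (s : seq Q)
    (B : nat) :
  all (fun y => #|[pred i | ~~ P i y]| <= B)%N s ->
  (#|[pred i | ~~ all (P i) s]| <= size s * B)%N.
Proof.
elim: s => [_|y s IH] /=; first by rewrite eq_card0.
case/andP => yB /IH sB; rewrite mulSn.
apply: leq_trans (leq_add yB sB).
rewrite -cardUI; apply: leq_trans (leq_addr _ _).
by apply: subset_leq_card; apply/fintype.subsetP => i; rewrite !inE negb_and.
Qed.

End SQ.

(** For each internal randomness, the runs against the lazy oracles are compared with one reference
    run. Too few indices can be told apart from the reference, or be served by its fixed output, for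
    an average success probability of 2/3. *)
Lemma sq_lower_bound (R : realType) (m M : nat) (eps d err t N : R)
    (I : finType) (S : I -> {set 'I_M}) (f : I -> cube M -> R) :
  (0 < #|I|)%N -> 0 < N ->
  (forall i, #|S i| = m) ->
  (forall i, is_pmf (fun x => 2^-M * (1 + f i x))) ->
  (forall i, dTV (fun x => 2^-M * (1 + f i x)) (Uprod (S i) d) <= eps) ->
  (forall q : cube M -> R, (forall x, -1 <= q x <= 1) ->
     #|[pred i | t < `|avg (fun x => q x * f i x)|]|%:R * N <= #|I|%:R / 4) ->
  (forall v : 'rV[R]_M, #|[pred i | l2norm (v - mean_vec (Uprod (S i) d)) <= err]|%:R
     <= #|I|%:R / 4 :> R) ->
  forall (disp : measure_display) (W : measurableType disp)
    (Pr : probability W R) (A : W -> sq_alg R M),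
  sq_estimates m eps d err Pr A ->
  uses_tol_below m eps d A t \/ uses_queries_at_least m eps d A N.
Proof.
move=> I0 N0 cardS pmfP tvP fewq fewv disp W Pr A estA.
have [?|notol] := pselect (uses_tol_below m eps d A t); first by left.
have [?|nocount] := pselect (uses_queries_at_least m eps d A N); first by right.
exfalso.
pose P i : cube M -> R := fun x => 2^-M * (1 + f i x).
pose O i := lazy_oracle (P i).
(* The reference oracle answers for the uniform distribution, which may be farther than [eps] from
   every [Uprod (S i) d]; bounds on its run must be transferred from the runs against [O i]. *)
pose O0 : oracle R M := fun q => avg (qfun q).
have inst i : instance m eps d (S i) (O i).
  split; first exact: cardS.
  by exists (P i); split; [exact: pmfP|exact: tvP|exact: lazy_oracleP].
have run_tol w i : all (fun q => t <= tol q) (sq_queries (A w) (O i)).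
  apply: contra_notT notol.
  rewrite -has_predC => h; exists (sq_queries (A w) (O i)); split.
    by exists w, (S i), (O i).
  by apply: sub_has h => q /=; rewrite ltNge.
have run_size w i : (size (sq_queries (A w) (O i)))%:R < N.
  rewrite ltNge; apply: contra_notN nocount => h.
  by exists (sq_queries (A w) (O i)); split => //; exists w, (S i), (O i).
pose agree i : pred (sq_query R M) := fun q => O i q == O0 q.
have disagree q : t <= tol q ->
    #|[pred i | ~~ agree i q]|%:R * N <= #|I|%:R / 4.
  move=> tq; apply: le_trans (fewq _ (@qfun_bounded _ _ q)).
  rewrite ler_pM2r // ler_nat; apply: subset_leq_card.
  apply/fintype.subsetP => i; rewrite !inE /agree /O /lazy_oracle /O0.
  case: ifP => [_|/negbT]; first by rewrite eqxx.
  rewrite -ltNge => h _; apply: le_lt_trans tq _; apply: lt_le_trans h _.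
  have -> : expect (P i) (qfun q) =
      avg (qfun q) + avg (fun x => qfun q x * f i x).
    rewrite -avgD; apply: eq_bigr => x _; rewrite /P /unif; ring.
  by rewrite opprD addNKr normrN.
pose B := Num.truncn (#|I|%:R / 4 / N).
have B0 : 0 <= #|I|%:R / 4 / N by rewrite !divr_ge0 // ltW.
have disagreeN q : t <= tol q -> (#|[pred i | ~~ agree i q]| <= B)%N.
  by move=> /disagree h; rewrite /B truncn_ge_nat // ler_pdivlMr.
have BN : B%:R * N <= #|I|%:R / 4.
  by rewrite -ler_pdivlMr // truncn_le.
have few_disagree s : all (fun q => t <= tol q) s -> (size s)%:R <= N ->
    #|[pred i | ~~ all (agree i) s]|%:R <= #|I|%:R / 4 :> R.
  move=> tols sN; apply: (@le_trans _ _ ((size s * B)%:R)).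
    by rewrite ler_nat card_not_all //; apply: sub_all tols.
  apply: le_trans BN; rewrite natrM mulrC ler_wpM2l //.
have Ipos : 0 < #|I|%:R :> R by rewrite ltr0n.
(* By induction on [n]: fewer than [N] queries of tolerance at least [t] leave some [O i] agreeing
   with all of them, so the next reference query is also asked in an admissible run and inherits its
   bounds. *)
have ref_run w n : (n <= size (sq_queries (A w) O0))%N ->
    all (fun q => t <= tol q) (take n (sq_queries (A w) O0)) /\ n%:R < N.
  elim: n => [_|n IH nsz]; first by rewrite take0.
  have [tols nN] := IH (ltnW nsz).
  have [i agi] : exists i, all (agree i) (take n (sq_queries (A w) O0)).
    apply: contrapT => /forallNP none.
    have := few_disagree _ tols.
    rewrite size_takel ?(ltnW nsz) // => /(_ (ltW nN)).
    rewrite (eq_card (B := predT)); first by rewrite -/#|_| => ?; lra.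
    by move=> i; rewrite !inE; apply/negP/none.
  have eq_take := sq_queries_agree agi.
  split.
    rewrite -eq_take; have := run_tol w i.
    by rewrite -{1}(cat_take_drop n.+1 (sq_queries _ _)) all_cat => /andP[].
  apply: le_lt_trans (run_size w i).
  rewrite ler_nat -(size_takel nsz) -eq_take size_take_min geq_minr //.
pose v w := sq_output (A w) O0.
pose good w := [pred i | l2norm (v w - mean_vec (Uprod (S i) d)) <= err].
pose succ w := [pred i | l2norm (sq_output (A w) (O i) -
  mean_vec (Uprod (S i) d)) <= err].
(* An index succeeds only if it disagrees somewhere on the reference run or if the reference output
   is good for it; each happens for at most a quarter of [I]. *)
have few_succ w : #|succ w|%:R <= (#|I|%:R / 2 : R).
  have [tols szN] := ref_run w _ (leqnn _).
  rewrite take_size in tols.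
  have h1 := few_disagree _ tols (ltW szN).
  have h2 := fewv (v w).
  have : (#|succ w| <=
      #|[pred i | ~~ all (agree i) (sq_queries (A w) O0)]| + #|good w|)%N.
    rewrite -cardUI; apply: leq_trans (leq_addr _ _).
    apply: subset_leq_card; apply/fintype.subsetP => i; rewrite !inE.
    by case: (boolP (all _ _)) => //= /sq_output_agree ->.
  rewrite -(ler_nat R) natrD => /le_trans; apply.
  by move: h2; rewrite -/(good w); lra.
have witness i : exists E : set W, [/\ measurable E,
    (E `<=` [set w | l2norm (sq_output (A w) (O i) -
       mean_vec (Uprod (S i) d)) <= err])%classic & ((2 / 3)%:E <= Pr E)%E].
  exact: estA (inst i).
have [E EP] := choice witness.
have mE i : measurable (E i) by case: (EP i).
have E_le w : \sum_i \1_(E i) w <= (#|I|%:R / 2 : R).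
  apply: le_trans (few_succ w).
  rewrite -sum1_card natr_sum [leRHS]big_mkcond /=; apply: ler_sum => i _.
  rewrite inE indicE; have [_ Ei _] := EP i.
  by case: (boolP (w \in E i)) => [/set_mem/Ei /= ->|_] //; case: ifP.
(* Averaging over [w]: success everywhere with probability 2/3 exceeds the half allowed by
   [few_succ]. *)
have := sum_probability_le Pr mE E_le.
rewrite leNgt => /negP; apply.
apply: (@lt_le_trans _ _ (\sum_(i : I) (2 / 3)%:E)%E).
  by rewrite sumEFin lte_fin sumr_const -mulr_natr; lra.
by apply: lee_sum => i _; case: (EP i).
Qed.

(** * Graphs as hard instances *)

Lemma expR_half_le2 (R : realType) : expR (2^-1 : R) <= 2.
Proof.
have := expR_ge1Dx (- 2^-1 : R); rewrite expRN => h.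
have e0 : 0 < expR (2^-1 : R) := expR_gt0 _.
have : 2^-1 <= (expR (2^-1 : R))^-1 by lra.
by rewrite lef_pV2 ?posrE.
Qed.

Section Family.
Variables (M m b : nat) (mbM : (m * b <= M)%N).

Lemma slot_subproof (i : 'I_m) (j : 'I_b) : (i * b + j < M)%N.
Proof.
apply: leq_trans mbM; apply: (@leq_trans (i * b + b)).
  by rewrite ltn_add2l.
by rewrite -mulSnr leq_mul2r ltn_ord orbT.
Qed.

Definition slot i j : 'I_M := Ordinal (slot_subproof i j).

Lemma slot_inj2 i i' j j' : slot i j = slot i' j' -> i = i' /\ j = j'.
Proof.
move=> /(congr1 val) /= e; have b0 : (0 < b)%N by apply: leq_ltn_trans (ltn_ord j).
split; apply: val_inj => /=.
  by have := congr1 (divn^~ b) e; rewrite !divnMDl // !divn_small // !addn0.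
by have := congr1 (modn^~ b) e; rewrite !modnMDl !modn_small.
Qed.

(** Graphs all have size [m], and the overlap of a fixed graph with a random one is a sum of
    independent row indicators. *)
Definition graph_set (phi : {ffun 'I_m -> 'I_b}) : {set 'I_M} :=
  [set slot i (phi i) | i in 'I_m].

Lemma card_graph_set phi : #|graph_set phi| = m.
Proof.
by rewrite card_imset ?card_ord // => i j /slot_inj2[].
Qed.

Lemma card_graph_setI phi psi :
  #|graph_set phi :&: graph_set psi| = #|[pred i | phi i == psi i]|.
Proof.
rewrite -(card_imset (f := fun i => slot i (phi i))); last first.
  by move=> i j /slot_inj2[].
apply: eq_card => l; rewrite inE; apply/andP/imsetP.
  case=> /imsetP[i _ ->] /imsetP[j _ /slot_inj2[ij e]].
  by exists i => //; rewrite inE e ij.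
case=> i; rewrite inE => /eqP e ->; split; apply/imsetP; exists i => //.
by rewrite e.
Qed.

Lemma graph_set_overlap_tail (R : realType) (r : nat)
    (phi : {ffun 'I_m -> 'I_b}) :
  (6 * m <= r * b)%N ->
  #|[pred psi | (r <= #|graph_set phi :&: graph_set psi|)%N]|%:R
    <= 2^-r * #|{ffun 'I_m -> 'I_b}|%:R :> R.
Proof.
move=> rb; have [m0|m0] := posnP m.
  have [r0|r0] := posnP r.
    by rewrite r0 expr0 invr1 mul1r ler_nat max_card.
  rewrite eq_card0 ?mulr_ge0 ?invr_ge0 ?exprn_ge0 // => psi.
  rewrite !inE leqNgt card_graph_setI (leq_ltn_trans (max_card _)) //.
  by rewrite card_ord m0.
have b0 : (0 < b)%N.
  by rewrite lt0n; apply: contraTN rb => /eqP ->; rewrite muln0 -ltnNge muln_gt0.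
have bR : 0 < b%:R :> R by rewrite ltr0n.
(* Markov's inequality for [4 ^ overlap], whose average factors over the rows *)
have sum4 : \sum_psi (4 ^ #|graph_set phi :&: graph_set psi|)%N = ((b + 3) ^ m)%N.
  transitivity (\sum_(psi : {ffun 'I_m -> 'I_b})
      \prod_i (if phi i == psi i then 4 else 1))%N.
    apply: eq_bigr => psi _; rewrite card_graph_setI -prod_nat_const.
    by rewrite [LHS]big_mkcond /=.
  rewrite -(bigA_distr_bigA (fun i j => if phi i == j then 4 else 1)%N) /=.
  transitivity (\prod_(i < m) (b + 3))%N; last by rewrite prod_nat_const card_ord.
  apply: eq_bigr => i _.
  rewrite (bigD1 (phi i)) //= eqxx (eq_bigr (fun=> 1%N)); last first.
    by move=> j; rewrite eq_sym => /negbTE ->.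
  by rewrite sum_nat_const muln1 cardC1 card_ord -[in RHS](prednK b0) addSnnS addnC.
have h4 : (#|[pred psi | (r <= #|graph_set phi :&: graph_set psi|)%N]| * 4 ^ r
    <= (b + 3) ^ m)%N.
  rewrite -sum4 -sum1_card big_distrl /= big_mkcond /=; apply: leq_sum => psi _.
  by rewrite inE; case: ifP => // h; rewrite mul1n leq_pexp2l.
rewrite card_ffun !card_ord natrX mulrC ler_pdivlMr ?exprn_gt0 //.
(* [6 * m <= r * b] gives [3 m / b <= r / 2], so the average of [4 ^ overlap] is at most
   [expR (1/2) ^ r <= 2 ^ r]; dividing by [4 ^ r] leaves [2 ^ -r]. *)
have : (b + 3)%:R ^+ m <= b%:R ^+ m * 2 ^+ r :> R.
  have -> : (b + 3)%:R = b%:R * (1 + 3 / b%:R) :> R.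
    by rewrite natrD; field; rewrite gt_eqF.
  rewrite exprMn ler_pM2l ?exprn_gt0 //.
  apply: (@le_trans _ _ (expR (3 / b%:R) ^+ m)).
    by apply: lerXn2r; rewrite ?nnegrE ?expR_ge1Dx ?expR_ge0 // addr_ge0 // divr_ge0.
  rewrite -expRM_natl; apply: (@le_trans _ _ (expR (r%:R * 2^-1))).
    rewrite ler_expR mulrCA mulrA ler_pdivrMr //.
    have : (6 * m)%:R <= (r * b)%:R :> R by rewrite ler_nat.
    rewrite !natrM; lra.
  by rewrite expRM_natl; apply: lerXn2r; rewrite ?nnegrE ?expR_ge0 ?expR_half_le2.
move=> hb; rewrite -(ler_pM2r (_ : 0 < 2 ^+ r)) ?exprn_gt0 //.
apply: le_trans hb; rewrite -mulrA -exprMn -!natrX -!natrM.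
by move: h4; rewrite -(ler_nat R) natrM !natrX; congr (_ * _ ^+ _ <= _); rewrite -natrM.
Qed.

End Family.

(* Each good [S i] has a large inner product with [v - 1/2], so the sum of the
   indicators of the good sets is long, whereas their overlaps are small. *)
Lemma few_good_estimates (R : realType) (M m r : nat) (I : finType)
    (S : I -> {set 'I_M}) (p C delta : R) (v : 'rV[R]_M) :
  (0 < m)%N -> 0 < C < 1 -> 0 < delta ->
  (forall i, #|S i| = m) ->
  (forall i, #|[pred j | (r <= #|S i :&: S j|)%N]|%:R <= p * #|I|%:R) ->
  r%:R + p * m%:R <= (1 - C ^+ 2) * m%:R / 4 ->
  #|[pred i | l2norm (v - mean_vec (Uprod (S i) (delta / Num.sqrt m%:R)))
      <= C * delta]|%:R <= #|I|%:R / 4 :> R.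
Proof.
move=> m0 /andP[C0 C1] dl0 cardS tail small.
set d := delta / _; set G := [pred i | _]; set g : R := #|G|%:R.
have mR : 0 < m%:R :> R by rewrite ltr0n.
have dm : d ^+ 2 * m%:R = delta ^+ 2.
  by rewrite /d expr_div_n sqr_sqrtr ?ler0n // divfK // gt_eqF.
have d0 : 0 < d by rewrite divr_gt0 // sqrtr_gt0.
have [G0|Gpos] := posnP #|G|; first by rewrite /g G0 divr_ge0.
have g0 : 0 < g by rewrite ltr0n.
pose u l := v 0 l - 2^-1.
pose U := \sum_l u l ^+ 2.
(* Expands the squared distance around 1/2; the squared norm of the centred mean is
   [d^2 m = delta^2]. *)
have close i : i \in G ->
    U + (1 - C ^+ 2) * delta ^+ 2 <= 2 * d * \sum_(l in S i) u l.
  rewrite inE /l2norm => h.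
  have : \sum_l (v - mean_vec (Uprod (S i) d)) 0 l ^+ 2 <= (C * delta) ^+ 2.
    rewrite -(@sqr_sqrtr _ (\sum_l _)) ?sumr_ge0 // => [|l _]; last exact: sqr_ge0.
    by rewrite lerXn2r // nnegrE ?sqrtr_ge0 // mulr_ge0 // ltW.
  have -> : \sum_l (v - mean_vec (Uprod (S i) d)) 0 l ^+ 2 =
      U - 2 * d * (\sum_(l in S i) u l) + d ^+ 2 * m%:R.
    rewrite -(cardS i) -sum1_card natr_sum !mulr_sumr.
    rewrite [\sum_(l in S i) _ * u l]big_mkcond [\sum_(l in S i) _ * 1]big_mkcond.
    rewrite /U -sumrB -big_split /=.
    apply: eq_bigr => l _; rewrite -/d 2!mxE.
    have := mean_vec_Uprod (S i) d l; rewrite mxE => ->.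
    by rewrite /u; case: ifP => _ /=; ring.
  rewrite dm; lra.
pose w l : R := \sum_(i in G) (l \in S i)%:R.
have sumX : \sum_(i in G) \sum_(l in S i) u l = \sum_l u l * w l.
  under eq_bigr do rewrite big_mkcond /=.
  rewrite exchange_big; apply: eq_bigr => l _; rewrite /w mulr_sumr.
  by apply: eq_bigr => i _; case: ifP => _ /=; rewrite ?mulr1 ?mulr0.
(* The square sum counts pairwise overlaps: below [r] for most pairs, and at most [m] for the
   fraction [p] of the others. *)
have sumw : \sum_l w l ^+ 2 <= g * (#|I|%:R * (r%:R + p * m%:R)).
  have -> : \sum_l w l ^+ 2 = \sum_(i in G) \sum_(j in G) #|S i :&: S j|%:R.
    under eq_bigr do rewrite expr2 /w mulr_suml.
    rewrite exchange_big; apply: eq_bigr => i _.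
    under eq_bigr do rewrite mulr_sumr.
    rewrite exchange_big; apply: eq_bigr => j _.
    rewrite -sum1_card natr_sum big_mkcond [RHS]big_mkcond /=.
    by apply: eq_bigr => l _; rewrite inE; case: (l \in S i); case: (l \in S j);
      rewrite /= ?mulr1 ?mulr0.
  apply: (@le_trans _ _ (\sum_(i in G) (#|I|%:R * (r%:R + p * m%:R)))); last first.
    by rewrite sumr_const -(mulr_natl (_ * _)).
  apply: ler_sum => i _.
  apply: (@le_trans _ _ (\sum_j #|S i :&: S j|%:R)).
    rewrite [leRHS](bigID (mem G)) /= lerDl; exact: sumr_ge0.
  apply: (@le_trans _ _ (\sum_j (r%:R + ((r <= #|S i :&: S j|)%N)%:R * m%:R))).
    apply: ler_sum => j _; case: (leqP r) => [_|/ltnW].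
      rewrite mul1r ler_wpDl // ler_nat -(cardS i).
      by apply: subset_leq_card; exact: subsetIl.
    by rewrite mul0r addr0 ler_nat.
  rewrite big_split /= sumr_const -(mulr_natl r%:R) mulrDr lerD2l -mulr_suml.
  rewrite mulrCA mulrA ler_pM2r //; apply: le_trans (tail i).
  rewrite -sum1_card natr_sum [leRHS]big_mkcond /=.
  by apply: ler_sum => j _; rewrite inE; case: (r <= _)%N.
have key : g * (U + (1 - C ^+ 2) * delta ^+ 2) <= 2 * d * \sum_l u l * w l.
  rewrite -sumX mulr_sumr /g mulr_natl -sumr_const.
  by apply: ler_sum => i; exact: close.
(* The weights make [g * U] cancel against the left side of [key], so the size of [v] drops out. *)
have amgm : 2 * d * \sum_l u l * w l <= g * U + d ^+ 2 / g * \sum_l w l ^+ 2.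
  rewrite /U !mulr_sumr -big_split; apply: ler_sum => l _ /=.
  rewrite -subr_ge0.
  have -> : g * u l ^+ 2 + d ^+ 2 / g * w l ^+ 2 - 2 * d * (u l * w l) =
     (g * u l - d * w l) ^+ 2 / g by field; rewrite gt_eqF.
  by rewrite divr_ge0 ?sqr_ge0 // ltW.
have h1 : g * ((1 - C ^+ 2) * delta ^+ 2) <=
    d ^+ 2 * (#|I|%:R * (r%:R + p * m%:R)).
  have : g * ((1 - C ^+ 2) * delta ^+ 2) <= d ^+ 2 / g * \sum_l w l ^+ 2 by nra.
  move=> /le_trans; apply.
  rewrite -mulrA ler_pM2l ?exprn_gt0 // mulrC ler_pdivrMr // mulrC.
  exact: sumw.
have {}h1 : g * ((1 - C ^+ 2) * m%:R) <= #|I|%:R * (r%:R + p * m%:R).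
  rewrite -(ler_pM2l (exprn_gt0 2 d0)).
  by move: h1; rewrite -dm; nra.
have Cm : 0 < (1 - C ^+ 2) * m%:R by rewrite mulr_gt0 // subr_gt0; nra.
rewrite -(ler_pM2r Cm); apply: le_trans h1 _.
have : #|I|%:R * (r%:R + p * m%:R) <= #|I|%:R * ((1 - C ^+ 2) * m%:R / 4).
  by rewrite ler_wpM2l.
lra.
Qed.

(** * Lagrange interpolation at squares *)

(** Factoring [j^2 - i^2 = (j - i)(j + i)] yields the runs [j-n .. j-1] and [j+1 .. j+n]; the factor
    [j] joins them and [(j-n-1)!] completes the factorial. *)
Lemma prod_dist_sq_lt (j n : nat) : (n < j)%N ->
  (\prod_(i < n) (j ^ 2 - i.+1 ^ 2) * (j - n.+1)`! * j = (j + n)`!)%N.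
Proof.
elim: n => [|n IH] nj.
  by rewrite big_ord0 mul1n addn0 subn1; case: j nj => // j _; rewrite factS mulnC.
rewrite big_ord_recr /= addnS factS -(IH (ltnW nj)).
have -> : (j - n.+1 = (j - n.+2).+1)%N by lia.
rewrite factS.
have -> : (j ^ 2 - n.+1 ^ 2 = (j - n.+2).+1 * (j + n).+1)%N.
  by rewrite subn_sqr; congr (_ * _)%N; lia.
by ring.
Qed.

(* The value 1 at [i = j] lets products skip that index. *)
Definition dist_sq (i j : nat) : nat :=
  if i == j then 1%N else ((i ^ 2 - j ^ 2) + (j ^ 2 - i ^ 2))%N.

(** Induction on [K - j]: [prod_dist_sq_lt] settles [K = j], and each further index [i] contributes
    [(i - j)(i + j)]. *)
Lemma prod_dist_sq (K j : nat) : (0 < j <= K)%N ->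
  (\prod_(i < K) dist_sq i.+1 j * (2 * j ^ 2) = (K - j)`! * (K + j)`!)%N.
Proof.
move=> /andP[j0 jK]; have := subnKC jK; move: (K - j)%N => t <- {K jK}.
elim: t => [|t IH].
  case: j j0 => // j _; rewrite addn0 fact0 mul1n big_ord_recr /=.
  rewrite {2}/dist_sq eqxx muln1.
  have -> : (\prod_(i < j) dist_sq i.+1 j.+1 = \prod_(i < j) (j.+1 ^ 2 - i.+1 ^ 2))%N.
    apply: eq_bigr => i _; rewrite /dist_sq eqSS ltn_eqF //.
    by rewrite (eqP (_ : _ - _ == 0)%N) // subn_eq0 leq_exp2r // ltnW // ltnS.
  have := prod_dist_sq_lt (ltnSn j); rewrite subnn fact0 muln1 => e.
  rewrite addnS factS -e expnS expn1.
  by rewrite (_ : (j.+1 + j).+1 = 2 * j.+1)%N; [ring | lia].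
rewrite addnS big_ord_recr /= {2}/dist_sq eqn_leq leqNgt (leq_ltn_trans (leq_addr t j)) //=.
rewrite (eqP (_ : j ^ 2 - _ == 0)%N); last first.
  by rewrite subn_eq0 leq_exp2r // ltnW // ltnS leq_addr.
rewrite addn0 subn_sqr.
have -> : ((j + t).+1 - j = t.+1)%N by lia.
by rewrite factS addSn factS mulnAC IH; ring.
Qed.

Lemma prod_sq_but (K j : nat) : (0 < j <= K)%N ->
  (\prod_(i < K) (if i.+1 == j then 1 else i.+1 ^ 2) * j ^ 2 = K`! ^ 2)%N.
Proof.
case: j => // j jK.
rewrite (bigD1 (Ordinal jK)) //= eqxx mul1n.
have -> : (K`! = \prod_(i < K) i.+1)%N.
  by rewrite fact_prod big_add1 big_mkord.
rewrite -!mulnn -big_split [RHS](bigD1 (Ordinal jK)) //= mulnC; congr (_ * _)%N.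
apply: eq_bigr => i; rewrite -val_eqE /= eqSS => /negbTE ->.
by rewrite mulnn.
Qed.

(** Passing from [j] to [j + 1] trades the factor [K - j] for the larger [K + j + 1]. *)
Lemma sqr_fact_le (K j : nat) : (j <= K)%N ->
  (K`! ^ 2 <= (K - j)`! * (K + j)`!)%N.
Proof.
elim: j => [|j IH] jK; first by rewrite subn0 addn0 expnS expn1.
apply: leq_trans (IH (ltnW jK)) _.
have -> : (K - j = (K - j.+1).+1)%N by lia.
rewrite addnS !factS mulnAC [leqRHS]mulnA mulnC mulnA leq_mul2r leq_mul2l.
by apply/orP; right; lia.
Qed.

Lemma fact_double_le (K : nat) : ((2 * K)`! <= 4 ^ K * K`! ^ 2)%N.
Proof.
elim: K => [//|K IH].
have -> : (2 * K.+1 = (2 * K).+2)%N by lia.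
rewrite !factS expnS.
have : ((2 * K).+2 * (2 * K).+1 * (2 * K)`! <=
  (2 * K.+1) ^ 2 * (4 ^ K * K`! ^ 2))%N.
  by apply: leq_mul => //; rewrite expnS expn1; apply: leq_mul; lia.
move=> h; apply: leq_trans (_ : _ <= _)%N _; last exact: eq_leq (erefl _).
rewrite mulnA; apply: leq_trans h _; rewrite !expnMn; lia.
Qed.

Section SquareNodes.
Variables (R : realType) (K : nat).

Lemma sum_inv_sq_le2 n : \sum_(i < n) (i.+1%:R ^+ 2)^-1 <= 2 :> R.
Proof.
case: n => [|n]; first by rewrite big_ord0.
(* The induction needs this sharper bound, which telescopes. *)
apply: (@le_trans _ _ (2 - n.+1%:R^-1)); last by rewrite lerBlDr lerDl.
elim: n => [|n IH]; first by rewrite big_ord1 expr1n invr1; lra.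
rewrite big_ord_recr /=; apply: le_trans (lerD IH (lexx _)) _.
have n0 : 0 < n.+1%:R :> R by [].
rewrite -subr_ge0 [n.+2%:R]mulrS.
have -> : 2 - (1 + n.+1%:R)^-1 - (2 - n.+1%:R^-1 + ((1 + n.+1%:R) ^+ 2)^-1) =
   (n.+1%:R * (1 + n.+1%:R) ^+ 2)^-1 :> R.
  by field; rewrite !gt_eqF // ltr_wpDl.
by rewrite invr_ge0 mulr_ge0 // exprn_ge0 // addr_ge0.
Qed.

Variable eta : R.

(** The parameters of the mixture divided by [- D / K^2]: the negative tilts become squares and [d]
    becomes [- eta]. *)
Definition node (j : nat) : R := (j ^ 2)%:R.

(* Value at [- eta] of the [j]-th Lagrange basis polynomial of the nodes
   [0, 1, 4, ..., K^2]. *)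
Definition lag (j : nat) : R :=
  \prod_(i < K.+1 | i != j :> nat) ((node i + eta) / (node i - node j)).

Lemma node_inj : injective node.
Proof. by move=> i j /eqP; rewrite eqr_nat eqn_exp2r // => /eqP. Qed.

(** Interpolation at [K + 1] nodes reproduces every monomial of degree at most [K]. *)
Lemma sum_lag_exp n : (n <= K)%N ->
  \sum_(j < K.+1) lag j * node j ^+ n = (- eta) ^+ n.
Proof.
move=> nK; have := @lagrange_gen R K.+1 node (ltn0Sn K) node_inj 'X^n.
rewrite size_polyXn => /(_ nK) /(congr1 (fun p => p.[- eta])).
rewrite horner_sum hornerXn => ->; apply: eq_bigr => j _.
rewrite hornerM hornerC hornerXn mulrC; congr (_ * _).
rewrite lagrangeE //; last exact: node_inj.
rewrite hornerM hornerC !horner_prod mulrC -prodf_div.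
apply: eq_bigr => i ij; rewrite !hornerXsubC -(opprB (node j) (node i)).
by rewrite invrN mulrN -mulNr opprD addrC.
Qed.

Hypothesis eta_bounds : 0 < eta <= 4^-1.
Let eta0 : 0 < eta. Proof. by case/andP: eta_bounds. Qed.

(** Numerators are positive, and exactly the [j] factors with [i < j] have a negative
    denominator. *)
Lemma lag_ge0 j : (j <= K)%N -> 0 <= (-1) ^+ j * lag j.
Proof.
move=> jK.
have -> : (-1) ^+ j = \prod_(i < K.+1 | i != j :> nat) (if (i < j)%N then -1 else 1) :> R.
  rewrite -big_mkcondr /= -[in LHS](card_ord j) -prodr_const.
  have jK' : (j <= K.+1)%N by apply: leqW.
  rewrite (big_ord_widen_cond _ predT (fun=> -1) jK') /=.
  by apply: eq_bigl => i; rewrite ltn_neqAle; case: (_ != _).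
rewrite -big_split /=; apply: prodr_ge0 => i ij.
have [lt|ge] := ltnP i j.
  rewrite mulN1r -mulrN -invrN opprB divr_ge0 //.
    by rewrite addr_ge0 ?ler0n // ltW.
  by rewrite subr_ge0 ler_nat leq_exp2r // ltnW.
rewrite mul1r divr_ge0 //; first by rewrite addr_ge0 ?ler0n // ltW.
by rewrite subr_ge0 ler_nat leq_exp2r.
Qed.

Lemma norm_lag (j : nat) : (0 < j <= K)%N ->
  `|lag j| = eta / j%:R ^+ 2 *
    (\prod_(i < K) (if i.+1 == j then 1 else i.+1%:R ^+ 2 + eta) /
     (\prod_(i < K) dist_sq i.+1 j)%:R).
Proof.
case/andP => j0 jK; rewrite /lag big_mkcond big_ord_recl /= ifT; last by rewrite eq_sym -lt0n.
rewrite normrM normr_prod natr_prod -prodf_div; congr (_ * _).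
  rewrite /node exp0n // sub0r add0r normrM normrV ?unitfE ?oppr_eq0; last first.
    by rewrite pnatr_eq0 -lt0n expn_gt0 j0.
  by rewrite normrN !ger0_norm ?natrX // ltW.
apply: eq_bigr => i _; rewrite /bump /= add1n /dist_sq.
case: eqP => [//|/eqP ij] /=; first by rewrite normr1 divr1.
rewrite normrM ger0_norm; last by rewrite addr_ge0 ?ler0n // ltW.
rewrite /node normfV; congr (_ / _); first by rewrite natrX.
have [le|/ltnW le] := leqP (i.+1 ^ 2) (j ^ 2).
  by rewrite (eqP le) add0n distrC ger0_norm ?natrB // subr_ge0 ler_nat.
by rewrite [(j ^ 2 - _)%N](eqP le) addn0 ger0_norm ?natrB // subr_ge0 ler_nat.
Qed.

Lemma prod_sq_but_real j : (0 < j <= K)%N ->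
  \prod_(i < K) (if i.+1 == j then 1 else i.+1%:R ^+ 2) =
  K`!%:R ^+ 2 / j%:R ^+ 2 :> R.
Proof.
move=> jK; have j0 : j%:R != 0 :> R by rewrite pnatr_eq0 -lt0n; case/andP: jK.
apply: (mulIf (expf_neq0 2 j0)); rewrite divfK ?expf_neq0 //.
rewrite -!natrX -(prod_sq_but jK) natrM natr_prod; congr (_ * _).
by apply: eq_bigr => i _; case: ifP => // _; rewrite natrX.
Qed.

Lemma dist_prodE j : (0 < j <= K)%N ->
  (\prod_(i < K) dist_sq i.+1 j)%:R =
  ((K - j)`! * (K + j)`!)%:R / (2 * j%:R ^+ 2) :> R.
Proof.
move=> jK; have j0 : j%:R != 0 :> R by rewrite pnatr_eq0 -lt0n; case/andP: jK.
rewrite -(prod_dist_sq jK) natrM [(2 * _)%:R]natrM natrX mulfK //.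
by rewrite mulf_neq0 ?expf_neq0 // pnatr_eq0.
Qed.

(** The node 0 contributes [eta / j^2]. In the other factors, replacing [i^2 + eta] by [i^2] costs
    at most [expR (eta * 2) <= 2] in total, as the inverse squares sum to at most 2; what remains is
    [2 K!^2 / ((K-j)! (K+j)!) <= 2]. *)
Lemma lag_le j : (0 < j <= K)%N -> `|lag j| <= 4 * eta / j%:R ^+ 2.
Proof.
move=> jK; have /andP[j0' jK'] := jK.
have j0 : 0 < j%:R :> R by rewrite ltr0n.
rewrite norm_lag // -[leRHS]mulrA [leRHS]mulrC ler_pM2l ?divr_gt0 ?exprn_gt0 //.
have F0 : 0 < ((K - j)`! * (K + j)`!)%:R :> R by rewrite ltr0n muln_gt0 !fact_gt0.
have D0 : 0 < (\prod_(i < K) dist_sq i.+1 j)%:R :> R.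
  by rewrite dist_prodE // divr_gt0 // mulr_gt0 // exprn_gt0.
rewrite ler_pdivrMr //.
apply: (@le_trans _ _ (\prod_(i < K) ((if i.+1 == j then 1 else i.+1%:R ^+ 2) *
    expR (eta * (i.+1%:R ^+ 2)^-1)))).
  apply: ler_prod => i _.
  have i0 : 0 < i.+1%:R ^+ 2 :> R by rewrite exprn_gt0.
  case: ifP => _.
    by rewrite ler01 mul1r ltW // pexpR_gt1 // mulr_gt0 // invr_gt0.
  rewrite addr_ge0 ?(ltW i0) ?(ltW eta0) //=.
  apply: (@le_trans _ _ (i.+1%:R ^+ 2 * (1 + eta * (i.+1%:R ^+ 2)^-1))).
    by rewrite mulrDr mulr1 mulrCA divff ?mulr1 // gt_eqF.
  by rewrite ler_pM2l // expR_ge1Dx.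
rewrite big_split /= prod_sq_but_real // -expR_sum -mulr_sumr.
have e2 : expR (eta * \sum_(i < K) (i.+1%:R ^+ 2)^-1) <= 2.
  apply: le_trans (expR_half_le2 R); rewrite ler_expR.
  have := sum_inv_sq_le2 K; have /andP[_ ?] := eta_bounds.
  by move=> h; apply: (@le_trans _ _ (eta * 2)); [rewrite ler_pM2l | lra].
rewrite dist_prodE //.
have Kf : K`!%:R ^+ 2 <= ((K - j)`! * (K + j)`!)%:R :> R.
  by rewrite -natrX ler_nat sqr_fact_le.
apply: (@le_trans _ _ (K`!%:R ^+ 2 / j%:R ^+ 2 * 2)).
  by rewrite ler_wpM2l // divr_ge0 // exprn_ge0.
apply: (@le_trans _ _ (((K - j)`! * (K + j)`!)%:R / j%:R ^+ 2 * 2)).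
  by rewrite ler_pM2r // ler_pM2r // invr_gt0 exprn_gt0.
by rewrite le_eqVlt; apply/orP; left; apply/eqP; field; rewrite gt_eqF.
Qed.

(** Dropping [eta] from the factors with nonzero node leaves [2 eta K!^2 / (K^2 (2K)!)], where
    [(2K)! <= 4^K K!^2] and [K^2 <= 4^K]. *)
Lemma lag_last_ge : (0 < K)%N -> eta / 16 ^+ K <= `|lag K|.
Proof.
move=> K0; have KK : (0 < K <= K)%N by rewrite K0 leqnn.
have K0R : 0 < K%:R :> R by rewrite ltr0n.
have f2 : 0 < (2 * K)`!%:R :> R by rewrite ltr0n fact_gt0.
rewrite norm_lag // dist_prodE // subnn fact0 mul1n addnn -mul2n.
rewrite -mulrA ler_pM2l //.
apply: (@le_trans _ _ ((K%:R ^+ 2)^-1 *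
    (K`!%:R ^+ 2 / K%:R ^+ 2 / ((2 * K)`!%:R / (2 * K%:R ^+ 2))))); last first.
  rewrite ler_pM2l ?invr_gt0 ?exprn_gt0 // ler_pM2r; last first.
    by rewrite invr_gt0 divr_gt0 // mulr_gt0 // exprn_gt0.
  rewrite -prod_sq_but_real //; apply: ler_prod => i _; case: ifP => _.
    by rewrite ler01 lexx.
  by rewrite exprn_ge0 //= lerDl ltW.
have -> : (K%:R ^+ 2)^-1 *
    (K`!%:R ^+ 2 / K%:R ^+ 2 / ((2 * K)`!%:R / (2 * K%:R ^+ 2))) =
    2 * K`!%:R ^+ 2 / (K%:R ^+ 2 * (2 * K)`!%:R) :> R.
  by field; rewrite !gt_eqF.
rewrite ler_pdivlMr ?mulr_gt0 ?exprn_gt0 // mulrC ler_pdivrMr ?exprn_gt0 //.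
rewrite -!natrX -!natrM ler_nat.
have h1 : (K ^ 2 <= 4 ^ K)%N.
  by rewrite (_ : 4 = 2 ^ 2)%N // -expnM mulnC expnM leq_exp2r // ltnW // ltn_expl.
apply: leq_trans (leq_mul h1 (fact_double_le K)) _.
rewrite mulnA -expnMn /= mulnC leq_mul2r; apply/orP; right.
by rewrite leq_pmull.
Qed.

Lemma lag0E : lag 0 - 1 = - \sum_(j < K) lag j.+1.
Proof.
have := sum_lag_exp (leq0n K); rewrite big_ord_recl !expr0 mulr1 => e.
rewrite (eq_bigr (fun j : 'I_K => lag j.+1)) in e; first by lra.
by move=> j _; rewrite expr0 mulr1.
Qed.

Lemma sum_norm_lag_le : \sum_(j < K) `|lag j.+1| <= 8 * eta.
Proof.
apply: (@le_trans _ _ (\sum_(j < K) 4 * eta * (j.+1%:R ^+ 2)^-1)).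
  by apply: ler_sum => j _; apply: lag_le; rewrite /= ltn_ord.
rewrite -mulr_sumr; have := sum_inv_sq_le2 K; have := eta0; nra.
Qed.

End SquareNodes.

(** * Mixtures of tilted measures *)

Lemma sum_exp_coeff_le (R : realType) (x : R) (n : nat) : 0 <= x ->
  \sum_(i < n) x ^+ i / i`!%:R <= expR x.
Proof.
move=> x0; rewrite -(big_mkord predT (fun i => x ^+ i / i`!%:R)).
apply: (@nondecreasing_cvgn_le R (series (exp_coeff x))).
  by apply: nondecreasing_series => i _ _; exact: exp_coeff_ge0.
exact: is_cvg_series_exp_coeff.
Qed.

Lemma bin_fact_le_expn (n i : nat) : ('C(n, i) * i`! <= n ^ i)%N.
Proof.
rewrite bin_ffact; elim: i => [//|i IH].
by rewrite ffactnSr expnSr leq_mul // leq_subr.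
Qed.

(** Bounds the height of [ln] above its chord. Averaging [ln c - ln y <= c / y - 1] over [y = a] and
    [y = b] gives [th (1 - th) (a - b)^2 / (a b)], and [1 / (a b) <= 4]. *)
Lemma ln_interp_le (R : realType) (th a b : R) :
  0 <= th <= 1 -> 2^-1 <= a -> 2^-1 <= b ->
  ln (th * a + (1 - th) * b) <=
    th * ln a + (1 - th) * ln b + 4 * th * (1 - th) * (a - b) ^+ 2.
Proof.
move=> /andP[th0 th1] a2 b2; set c := _ + _.
have a0 : 0 < a by lra.
have b0 : 0 < b by lra.
have c0 : 0 < c by rewrite /c; nra.
have lnD (y : R) : 0 < y -> ln c - ln y <= c / y - 1.
  move=> y0; rewrite -lnV ?posrE // -lnM ?posrE ?invr_gt0 //.
  have := @le_ln1Dx R (c / y - 1); rewrite addrCA subrr addr0; apply.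
  by rewrite ltrBrDl subrr divr_gt0.
have ha := lnD a a0; have hb := lnD b b0.
have e : th * (c / a - 1) + (1 - th) * (c / b - 1) =
    th * (1 - th) * (a - b) ^+ 2 * (a * b)^-1.
  by rewrite /c; field; rewrite !gt_eqF.
have ab4 : (a * b)^-1 <= 4.
  have -> : 4 = (2^-1 * 2^-1)^-1 :> R by field.
  by rewrite lef_pV2 ?posrE ?mulr_gt0 //; apply: ler_pM => //; lra.
have q0 : 0 <= th * (1 - th) * (a - b) ^+ 2.
  by rewrite mulr_ge0 ?sqr_ge0 // mulr_ge0 //; lra.
have h1 : th * (ln c - ln a) <= th * (c / a - 1) by rewrite ler_wpM2l.
have h2 : (1 - th) * (ln c - ln b) <= (1 - th) * (c / b - 1).
  by rewrite ler_wpM2l //; lra.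
have h3 := ler_wpM2l q0 ab4.
lra.
Qed.

Section Tilts.
Variables (R : realType) (M : nat).
Implicit Types (S : {set 'I_M}) (x : cube M).

Lemma tilt_gt0 S (e : R) x : `|e| <= 4^-1 -> 0 < tilt S e x.
Proof.
rewrite ler_norml => /andP[e1 e2]; apply: prodr_gt0 => i _.
by case: ifP => // _; case: ifP => _; lra.
Qed.

Definition log_tilt S (e : R) x : R :=
  \sum_(i in S) ln (if x i then 1 + 2 * e else 1 - 2 * e).

Lemma tiltE S (e : R) x : `|e| <= 4^-1 -> tilt S e x = expR (log_tilt S e x).
Proof.
rewrite ler_norml => /andP[e1 e2]; rewrite expR_sum [RHS]big_mkcond /=.
apply: eq_bigr => i _; case: ifP => // _.
by rewrite lnK // posrE; case: ifP => _; lra.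
Qed.

(** [ln_interp_le] on each coordinate, with [a - b] equal to [2 (d - d')] up to sign. The error
    keeps its factor [th], to be compared with a gain that is also linear in [th]. *)
Lemma log_tilt_interp S (th d d' : R) x :
  0 <= th <= 1 -> `|d| <= 4^-1 -> `|d'| <= 4^-1 ->
  log_tilt S (th * d + (1 - th) * d') x <=
    th * log_tilt S d x + (1 - th) * log_tilt S d' x
    + 16 * #|S|%:R * th * (d - d') ^+ 2.
Proof.
move=> th01; rewrite !ler_norml => /andP[d1 d2] /andP[d'1 d'2].
have /andP[th0 th1] := th01.
have -> : 16 * #|S|%:R * th * (d - d') ^+ 2 =
    \sum_(i in S) 16 * th * (d - d') ^+ 2.
  by rewrite sumr_const -[RHS]mulr_natr; ring.
rewrite /log_tilt !mulr_sumr -!big_split; apply: ler_sum => i _ /=.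
have q : 0 <= 16 * th * (d - d') ^+ 2 by rewrite mulr_ge0 ?sqr_ge0 // mulr_ge0.
have q2 : 4 * th * (1 - th) * (2 * d - 2 * d') ^+ 2 <= 16 * th * (d - d') ^+ 2.
  rewrite -subr_ge0 (_ : _ - _ = 16 * th ^+ 2 * (d - d') ^+ 2); last by ring.
  by rewrite mulr_ge0 ?sqr_ge0 // mulr_ge0 ?sqr_ge0.
case: ifP => _.
  have := @ln_interp_le R th (1 + 2 * d) (1 + 2 * d') th01.
  have -> : th * (1 + 2 * d) + (1 - th) * (1 + 2 * d') =
    1 + 2 * (th * d + (1 - th) * d') by ring.
  have -> : 1 + 2 * d - (1 + 2 * d') = 2 * d - 2 * d' by ring.
  by move=> h; apply: le_trans (h _ _) _; lra.
have := @ln_interp_le R th (1 - 2 * d) (1 - 2 * d') th01.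
have -> : th * (1 - 2 * d) + (1 - th) * (1 - 2 * d') =
  1 - 2 * (th * d + (1 - th) * d') by ring.
have -> : (1 - 2 * d - (1 - 2 * d')) ^+ 2 = (2 * d - 2 * d') ^+ 2 by ring.
by move=> h; apply: le_trans (h _ _) _; lra.
Qed.

(** The binomial expansion of [(1 + 4 e_a e_b)^n] separates [a] from [b], so each order contributes
    the square of a moment. *)
Lemma avg_mixture2 (S S' : {set 'I_M}) (N : nat) (w e : nat -> R) :
  avg (fun x => (\sum_(a < N) w a * tilt S (e a) x) *
                (\sum_(b < N) w b * tilt S' (e b) x)) =
  \sum_(i < #|S :&: S'|.+1)
    'C(#|S :&: S'|, i)%:R * 4 ^+ i * (\sum_(a < N) w a * e a ^+ i) ^+ 2.
Proof.
set n := #|_|.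
transitivity (\sum_(a < N) \sum_(b < N) w a * w b * (1 + 4 * e a * e b) ^+ n).
  rewrite (eq_avg _ (fun x => \sum_(a < N) \sum_(b < N)
      (w a * w b) * (tilt S (e a) x * tilt S' (e b) x))); last first.
    move=> x; rewrite mulr_suml; apply: eq_bigr => a _.
    by rewrite mulr_sumr; apply: eq_bigr => b _; ring.
  rewrite avg_sum; apply: eq_bigr => a _; rewrite avg_sum; apply: eq_bigr => b _.
  by rewrite avgZ avg_tilt2.
transitivity (\sum_(a < N) \sum_(b < N) \sum_(i < n.+1)
    'C(n, i)%:R * 4 ^+ i * ((w a * e a ^+ i) * (w b * e b ^+ i))).
  apply: eq_bigr => a _; apply: eq_bigr => b _.
  rewrite exprDn mulr_sumr; apply: eq_bigr => i _.
  by rewrite expr1n mul1r -mulr_natl !exprMn; ring.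
under eq_bigr do rewrite exchange_big /=.
rewrite exchange_big /=; apply: eq_bigr => i _.
rewrite expr2 mulr_suml mulr_sumr; apply: eq_bigr => a _.
by rewrite !mulr_sumr.
Qed.

End Tilts.

(** * Matching moments *)

Section MatchedMoments.
Variables (R : realType) (K : nat) (D eta : R).
Hypotheses (oddK : odd K) (eta_bounds : 0 < eta <= 4^-1) (D_bounds : 0 < D <= 4^-1).

Let K0 : (0 < K)%N. Proof. by case: K oddK. Qed.
Let KR0 : 0 < K%:R :> R. Proof. by rewrite ltr0n. Qed.
Let eta0 : 0 < eta. Proof. by case/andP: eta_bounds. Qed.
Let D0 : 0 < D. Proof. by case/andP: D_bounds. Qed.

Let scale : R := D / K%:R ^+ 2.
Let scale0 : 0 < scale. Proof. by rewrite divr_gt0 // exprn_gt0. Qed.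

Definition base_tilt : R := D / K%:R ^+ 2 * eta.

Definition tilt_node (j : nat) : R := - (D / K%:R ^+ 2 * node R j).

(** The constant 1 is the tilt at the node 0; absorbing it turns the coefficient there, close to 1,
    into one of order [eta] like the others. *)
Definition corr_weight (j : nat) : R := lag K eta j - (j == 0)%:R.

(* [1 + matched S] is the density of P_S with respect to the uniform
   distribution; [base_tilt] plays the role of d. *)
Definition matched M (S : {set 'I_M}) (x : cube M) : R :=
  tilt S base_tilt x - \sum_(j < K.+1) lag K eta j * tilt S (tilt_node j) x.

Let base_tilt_le : 0 <= base_tilt <= D.
Proof.
rewrite /base_tilt -/scale mulr_ge0 ?(ltW scale0) ?(ltW eta0) //=; have /andP[_ e4] := eta_bounds.
have K1 : 1 <= K%:R :> R by rewrite ler1n.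
rewrite /scale mulrAC ler_pdivrMr ?exprn_gt0 // ler_pM2l //; nra.
Qed.

Let norm_base_tilt : `|base_tilt| <= 4^-1.
Proof.
have /andP[h1 h2] := base_tilt_le; have /andP[_ h3] := D_bounds.
by rewrite ger0_norm // (le_trans h2).
Qed.

Let tilt_node_bounds j : (j <= K)%N -> - D <= tilt_node j <= 0.
Proof.
move=> jK; rewrite /tilt_node lerN2 oppr_le0 mulr_ge0 ?ler0n ?(ltW scale0) // andbT.
rewrite mulrAC ler_pdivrMr ?exprn_gt0 // ler_pM2l // -natrX ler_nat.
by rewrite leq_exp2r.
Qed.

Let norm_tilt_node j : (j <= K)%N -> `|tilt_node j| <= D.
Proof.
move=> /tilt_node_bounds /andP[h1 h2]; rewrite ler_norml h1 /=.
by apply: le_trans h2 _; apply: ltW.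
Qed.

Let norm_tilt_node4 j : (j <= K)%N -> `|tilt_node j| <= 4^-1.
Proof. by move=> /norm_tilt_node /le_trans; apply; case/andP: D_bounds. Qed.

Lemma tilt_node0 : tilt_node 0 = 0.
Proof. by rewrite /tilt_node /node exp0n // mulr0 oppr0. Qed.

Lemma tilt_node_last : tilt_node K = - D.
Proof. by rewrite /tilt_node /node natrX divfK // expf_neq0 // gt_eqF. Qed.

Lemma one_plus_matched M (S : {set 'I_M}) x :
  1 + matched S x =
  tilt S base_tilt x - \sum_(j < K.+1) corr_weight j * tilt S (tilt_node j) x.
Proof.
rewrite /matched /corr_weight !big_ord_recl /= tilt_node0 tilt0 !mulr1.
rewrite [in RHS](eq_bigr (fun j : 'I_K => lag K eta (bump 0 j) *
  tilt S (tilt_node (bump 0 j)) x)) => [|j _]; last by rewrite subr0.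
by ring.
Qed.

Lemma norm_corr_weight_le j : (j <= K)%N -> `|corr_weight j| <= 8 * eta.
Proof.
rewrite /corr_weight; case: j => [_|j jK].
  rewrite lag0E normrN; apply: le_trans (ler_norm_sum _ _ _) _.
  exact: sum_norm_lag_le.
rewrite subr0; apply: le_trans (sum_norm_lag_le K eta_bounds).
rewrite (bigD1 (Ordinal jK)) //= lerDl; exact: sumr_ge0.
Qed.

Lemma sum_norm_corr_weight_le : \sum_(j < K.+1) `|corr_weight j| <= 16 * eta.
Proof.
rewrite big_ord_recl /=; have := norm_corr_weight_le (leq0n K).
have := sum_norm_lag_le K eta_bounds.
rewrite (eq_bigr (fun j : 'I_K => `|corr_weight (bump 0 j)|)); first by lra.
by move=> j _; rewrite /corr_weight subr0.
Qed.

Lemma dTV_matched M (S : {set 'I_M}) :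
  dTV (fun x => 2^-M * (1 + matched S x)) (Uprod S base_tilt) <= 8 * eta.
Proof.
rewrite dTV_avgE -ler_pdivlMl ?invr_gt0 // invrK.
apply: (@le_trans _ _ (\sum_(j < K.+1) `|corr_weight j|)); last first.
  by apply: le_trans sum_norm_corr_weight_le _; lra.
have -> : \sum_(j < K.+1) `|corr_weight j| = \sum_(j < K.+1)
    avg (fun x => `|corr_weight j| * tilt S (tilt_node j) x).
  by apply: eq_bigr => j _; rewrite avgZ avg_tilt mulr1.
rewrite -avg_sum; apply: le_avg => x.
rewrite one_plus_matched addrAC subrr add0r normrN.
apply: le_trans (ler_norm_sum _ _ _) _; apply: ler_sum => j _.
by rewrite normrM [`|tilt _ _ _|]gtr0_norm // tilt_gt0 // norm_tilt_node4 // -ltnS.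
Qed.

Lemma avg_matched M (S : {set 'I_M}) : avg (matched S) = 0.
Proof.
rewrite (eq_avg _ (fun x => tilt S base_tilt x +
   \sum_(j < K.+1) (- lag K eta j) * tilt S (tilt_node j) x)); last first.
  by move=> x; rewrite /matched -sumrN; congr (_ + _); apply: eq_bigr => j _; rewrite mulNr.
rewrite avgD avg_tilt avg_sum (eq_bigr (fun j : 'I_K.+1 => - (lag K eta j * node R j ^+ 0))).
  by rewrite sumrN sum_lag_exp // expr0 subrr.
by move=> j _; rewrite avgZ avg_tilt expr0 !mulr1.
Qed.

Let w (a : nat) : R := if a is j.+1 then - lag K eta j else 1.
Let e (a : nat) : R := if a is j.+1 then tilt_node j else base_tilt.

Let matchedE M (S : {set 'I_M}) x :
  matched S x = \sum_(a < K.+2) w a * tilt S (e a) x.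
Proof.
rewrite /matched [in RHS]big_ord_recl /= mul1r -sumrN; congr (_ + _).
by apply: eq_bigr => j _; rewrite mulNr.
Qed.

Let moment_eq0 i : (i <= K)%N -> \sum_(a < K.+2) w a * e a ^+ i = 0.
Proof.
move=> iK; rewrite big_ord_recl /= mul1r.
rewrite (eq_bigr (fun j : 'I_K.+1 =>
   - (- scale) ^+ i * (lag K eta j * node R j ^+ i))) => [|j _].
  by rewrite -mulr_sumr sum_lag_exp // mulNr -exprMn mulrNN subrr.
by rewrite /= /tilt_node -/scale -mulNr exprMn; ring.
Qed.

Let moment_le i : (K < i)%N -> `|\sum_(a < K.+2) w a * e a ^+ i| <= 9 * eta * D ^+ i.
Proof.
move=> Ki; rewrite big_ord_recl /= mul1r big_ord_recl /= tilt_node0.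
have i0 : (0 < i)%N by apply: leq_ltn_trans Ki.
(* The node 0, whose coefficient is not small, has no moment of positive order. *)
rewrite expr0n gtn_eqF // mulr0 add0r.
apply: le_trans (ler_normD _ _) _.
rewrite (_ : 9 * eta * D ^+ i = eta * D ^+ i + 8 * eta * D ^+ i); last by ring.
have /andP[_ e4] := eta_bounds.
apply: lerD.
  have /andP[s0 _] := base_tilt_le.
  have h : base_tilt <= eta * D.
    rewrite /base_tilt mulrC ler_pM2l // ler_pdivrMr ?exprn_gt0 //.
    by rewrite ler_peMr ?(ltW D0) // exprn_ege1 // ler1n.
  rewrite normrX ger0_norm //; apply: (@le_trans _ _ ((eta * D) ^+ i)).
    by rewrite lerXn2r ?nnegrE ?(mulr_ge0 (ltW eta0) (ltW D0)).
  rewrite exprMn ler_pM2r ?exprn_gt0 // ler_iXnr ?(ltW eta0) //; lra.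
apply: le_trans (ler_norm_sum _ _ _) _.
apply: (@le_trans _ _ (\sum_(j < K) `|lag K eta j.+1| * D ^+ i)).
  apply: ler_sum => j _; rewrite normrM normrN normrX.
  apply: ler_wpM2l => //; apply: lerXn2r; rewrite ?nnegrE ?(ltW D0) //.
  by apply: norm_tilt_node; exact: ltn_ord.
by rewrite -mulr_suml ler_pM2r ?exprn_gt0 // sum_norm_lag_le.
Qed.

(** Only orders [i > K] survive. Each is at most [81 eta^2 rho^i l^i / i!]; the power of [rho] is
    weakened to [K + 1] and the rest sums to the exponential series. *)
Lemma matched_corr M (S S' : {set 'I_M}) (rho l : R) :
  0 <= rho <= 1 -> 0 <= l -> 4 * #|S :&: S'|%:R * D ^+ 2 <= rho * l ->
  `|avg (fun x => matched S x * matched S' x)|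
    <= 81 * eta ^+ 2 * rho ^+ K.+1 * expR l.
Proof.
move=> /andP[rho0 rho1] l0; set n := #|_| => nD.
rewrite (eq_avg _ (fun x => (\sum_(a < K.+2) w a * tilt S (e a) x) *
   (\sum_(a < K.+2) w a * tilt S' (e a) x))); last by move=> x; rewrite !matchedE.
rewrite avg_mixture2 -/n; apply: le_trans (ler_norm_sum _ _ _) _.
have c0 : 0 <= 81 * eta ^+ 2 * rho ^+ K.+1.
  by rewrite mulr_ge0 ?exprn_ge0 // mulr_ge0 ?exprn_ge0 ?(ltW eta0).
apply: (@le_trans _ _ (\sum_(i < n.+1)
    81 * eta ^+ 2 * rho ^+ K.+1 * (l ^+ i / i`!%:R))); last first.
  by rewrite -mulr_sumr ler_wpM2l // sum_exp_coeff_le.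
apply: ler_sum => i _; rewrite ger0_norm; last first.
  by rewrite mulr_ge0 ?sqr_ge0 // mulr_ge0 // exprn_ge0.
have rhs0 : 0 <= l ^+ i / i`!%:R by rewrite divr_ge0 ?exprn_ge0.
have [iK|Ki] := leqP i K.
  by rewrite moment_eq0 // expr0n mulr0 mulr_ge0.
have f0 : 0 < i`!%:R :> R by rewrite ltr0n fact_gt0.
apply: (@le_trans _ _ (n%:R ^+ i / i`!%:R * 4 ^+ i * (9 * eta * D ^+ i) ^+ 2)).
  apply: ler_pM => //; rewrite ?sqr_ge0 ?mulr_ge0 ?exprn_ge0 //.
    rewrite ler_pM2r ?exprn_gt0 // ler_pdivlMr //.
    by rewrite -natrX -natrM ler_nat bin_fact_le_expn.
  have rhs9 := le_trans (normr_ge0 _) (moment_le Ki).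
  rewrite -(real_normK (num_real _)); apply: lerXn2r; rewrite ?nnegrE //.
  exact: moment_le.
have -> : n%:R ^+ i / i`!%:R * 4 ^+ i * (9 * eta * D ^+ i) ^+ 2 =
    81 * eta ^+ 2 * ((4 * n%:R * D ^+ 2) ^+ i / i`!%:R).
  rewrite [(4 * n%:R * _) ^+ i]exprMn [(4 * _) ^+ i]exprMn [(9 * _ * _) ^+ 2]exprMn.
  rewrite (_ : (D ^+ i) ^+ 2 = (D ^+ 2) ^+ i); last by rewrite -!exprM mulnC.
  move: (n%:R ^+ i) (4 ^+ i) ((D ^+ 2) ^+ i) => y1 y2 y3.
  by field; rewrite gt_eqF.
rewrite -[leRHS]mulrA ler_pM2l ?mulr_gt0 ?exprn_gt0 // mulrA ler_pM2r ?invr_gt0 //.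
apply: (@le_trans _ _ ((rho * l) ^+ i)).
  by apply: lerXn2r; rewrite ?nnegrE // mulr_ge0 ?sqr_ge0 // mulr_ge0.
rewrite exprMn ler_wpM2r ?exprn_ge0 //.
by rewrite ler_wiXn2l.
Qed.

Section Positivity.
Variables (m : nat) (l : R).
Hypotheses (eta_le : eta <= expR (- l)) (mD : 256 * m%:R * D ^+ 2 <= l)
  (Kl : 22 * K%:R ^+ 2 <= l).

(* [tilt_node j] is the convex combination of [base_tilt] and [- D] with weight
   th on the former.  Geometric interpolation between the two extreme tilts
   underestimates the concave [log_tilt] by at most th * l / 4, which the factor
   eta ^ th <= expR (- th * l) gained from the coefficients absorbs. *)
Lemma corr_weight_tilt_le M (S : {set 'I_M}) x j : #|S| = m -> (j < K)%N ->
  corr_weight j * tilt S (tilt_node j) x <=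
    (tilt S base_tilt x + `|lag K eta K| * tilt S (- D) x) / K%:R.
Proof.
move=> Sm jK; have jK' := ltnW jK.
have nD4 : `|- D| <= 4^-1 by rewrite -tilt_node_last norm_tilt_node4.
have t1 := tilt_gt0 S x norm_base_tilt.
have t2 := tilt_gt0 S x nD4.
have t3 := tilt_gt0 S x (norm_tilt_node4 jK').
have lagK := lag_last_ge eta_bounds K0.
have e16 : 0 < eta / 16 ^+ K by rewrite divr_gt0 // exprn_gt0.
have lagK0 : 0 < `|lag K eta K| by apply: lt_le_trans lagK.
have rhs0 : 0 <= (tilt S base_tilt x + `|lag K eta K| * tilt S (- D) x) / K%:R.
  by rewrite divr_ge0 // addr_ge0 ?mulr_ge0 ?ltW.
have [neg|pos] := lerP (corr_weight j) 0.
  by apply: le_trans rhs0; rewrite pmulr_lle0.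
have cw : corr_weight j <= 8 * eta.
  by apply: le_trans (norm_corr_weight_le jK'); exact: ler_norm.
have /andP[sh0 shD] := base_tilt_le.
have sD : 0 < base_tilt + D by rewrite ltr_wpDl.
pose th : R := (D - scale * node R j) / (base_tilt + D).
have thE : th * base_tilt + (1 - th) * (- D) = tilt_node j.
  rewrite /tilt_node -/scale /th; field; rewrite gt_eqF //.
have sK : D = scale * K%:R ^+ 2 by rewrite /scale divfK // expf_neq0 // gt_eqF.
have nj : node R j <= (K%:R - 1) ^+ 2.
  have jK1 : j%:R + 1 <= K%:R :> R by rewrite natr1 ler_nat.
  have j0 := ler0n R j.
  by rewrite /node natrX; apply: lerXn2r; rewrite ?nnegrE; lra.
(* For [j < K] the node leaves at least [scale * (2 K - 1)] of [D = scale * K^2], while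
   [base_tilt + D <= 2 D]. *)
have th_lower : 1 <= th * (2 * K%:R).
  rewrite /th mulrAC ler_pdivlMr // mul1r.
  have : scale * node R j <= scale * (K%:R - 1) ^+ 2 by rewrite ler_pM2l.
  have : 1 <= K%:R :> R by rewrite ler1n.
  have := scale0; nra.
have th0 : 0 <= th by rewrite -(pmulr_lge0 _ (mulr_gt0 (ltr0Sn _ 1) KR0)); lra.
have th1 : th <= 1.
  rewrite /th ler_pdivrMr // mul1r.
  have : 0 <= scale * node R j by rewrite mulr_ge0 ?ler0n ?ltW.
  lra.
have := @log_tilt_interp R M S th base_tilt (- D) x; rewrite thE => /(_ _ norm_base_tilt nD4).
rewrite th0 th1 => /(_ isT); rewrite Sm opprK => interp.
set X := log_tilt S base_tilt x in interp.
set Y := log_tilt S (- D) x in interp.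
set Z := log_tilt S (tilt_node j) x in interp.
have gap : 16 * m%:R * th * (base_tilt + D) ^+ 2 <= th * l / 4.
  have h1 : (base_tilt + D) ^+ 2 <= 4 * D ^+ 2 by nra.
  have h2 := ler_wpM2l (ler0n R m) h1.
  have h3 : m%:R * (base_tilt + D) ^+ 2 <= l / 64 by move: mD; lra.
  have := ler_wpM2l th0 h3; lra.
have ln_eta : ln eta <= - l.
  by rewrite -(expRK (- l)) ler_ln ?posrE ?expR_gt0.
have ln2 : ln 2 <= 1 :> R.
  have := @le_ln1Dx R 1; rewrite (_ : 1 + 1 = 2) //; apply; lra.
have ln_cw : ln (corr_weight j) <= 3 + ln eta.
  apply: (@le_trans _ _ (ln (8 * eta))).
    by rewrite ler_ln ?posrE // mulr_gt0.
  rewrite lnM ?posrE // lerD2r (_ : 8 = 2 ^+ 3); last by ring.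
  by rewrite lnXn // -(mulr_natl (ln 2)); lra.
have ln_lagK : ln eta - 4 * K%:R <= ln `|lag K eta K|.
  apply: (@le_trans _ _ (ln (eta / 16 ^+ K))); last first.
    by rewrite ler_ln ?posrE.
  rewrite lnM ?posrE ?invr_gt0 ?exprn_gt0 // lnV ?posrE ?exprn_gt0 // lerD2l lerN2.
  rewrite (_ : 16 = 2 ^+ 4); last by ring.
  rewrite -exprM lnXn // -(mulr_natl (ln 2)).
  by apply: le_trans (ler_wpM2l (ler0n _ _) ln2) _; rewrite mulr1 natrM.
have ln_K : ln K%:R <= K%:R :> R.
  have h : -1 < K%:R - 1 :> R by rewrite ltrBrDl subrr.
  by have := le_ln1Dx h; rewrite addrCA subrr addr0; lra.
set y := ln `|lag K eta K| in ln_lagK.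
have expo : ln (corr_weight j) + Z <= Num.max X (y + Y) - ln K%:R.
  have hX : X <= Num.max X (y + Y) by rewrite le_max lexx.
  have hY : y + Y <= Num.max X (y + Y) by rewrite le_max lexx orbT.
  have avgXY : th * X + (1 - th) * (y + Y) <= Num.max X (y + Y).
    have h1 := ler_wpM2l th0 hX.
    have h2 : (1 - th) * (y + Y) <= (1 - th) * Num.max X (y + Y).
      by rewrite ler_wpM2l // subr_ge0.
    lra.
  have h3 : (1 - th) * (ln eta - 4 * K%:R) <= (1 - th) * y.
    by rewrite ler_wpM2l // subr_ge0.
  have h4 : th * ln eta <= th * (- l) by rewrite ler_wpM2l.
  have K1 : 1 <= K%:R :> R by rewrite ler1n.
  (* The losses are 3 from the factor 8, [4 K] from [16 ^ K] and [ln K <= K], together at most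
     [8 K]. The gain is [th * l] less the quarter spent on [gap], and [Kl] with [th_lower] gives
     [th * l >= 11 K]. *)
  have h5 : 8 * K%:R <= 3 / 4 * (th * l).
    have h6 : th * (22 * K%:R ^+ 2) <= th * l by rewrite ler_wpM2l.
    have h7 : 1 * K%:R <= th * (2 * K%:R) * K%:R by rewrite ler_pM2r.
    nra.
  nra.
have -> : corr_weight j * tilt S (tilt_node j) x = expR (ln (corr_weight j) + Z).
  by rewrite expRD lnK ?posrE // tiltE // norm_tilt_node4.
apply: (@le_trans _ _ (expR (Num.max X (y + Y) - ln K%:R))).
  by rewrite ler_expR.
rewrite expRB lnK ?posrE // ler_pM2r ?invr_gt0 //.
have -> : tilt S base_tilt x = expR X by rewrite tiltE.
have -> : `|lag K eta K| * tilt S (- D) x = expR (y + Y).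
  by rewrite expRD lnK ?posrE // tiltE.
have [_|_] := leP X (y + Y); first by rewrite lerDr expR_ge0.
by rewrite lerDl expR_ge0.
Qed.

(** Each node before the last takes a share [1 / K] of the two dominant terms, the tilts at
    [base_tilt] and at [- D]. *)
Lemma matched_pmf M (S : {set 'I_M}) : #|S| = m ->
  is_pmf (fun x => 2^-M * (1 + matched S x)).
Proof.
move=> Sm; split=> [x|]; last first.
  rewrite -[LHS]/(avg (fun x => 1 + matched S x)) avgD avg_cst.
  by rewrite avg_matched addr0.
rewrite mulr_ge0 ?invr_ge0 ?exprn_ge0 // one_plus_matched subr_ge0.
rewrite big_ord_recr /= tilt_node_last.
have -> : corr_weight K = - `|lag K eta K|.
  rewrite /corr_weight gtn_eqF // subr0.
  have := lag_ge0 eta_bounds (leqnn K).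
  by rewrite -signr_odd oddK expr1 mulN1r oppr_ge0 => /ler0_norm ->; rewrite opprK.
rewrite mulNr lerBlDr.
apply: (@le_trans _ _ (\sum_(j < K)
   (tilt S base_tilt x + `|lag K eta K| * tilt S (- D) x) / K%:R)).
  by apply: ler_sum => j _; exact: corr_weight_tilt_le.
by rewrite sumr_const card_ord -[leLHS]mulr_natr divfK // gt_eqF.
Qed.

End Positivity.

End MatchedMoments.

(** * Hard distributions for given [eps] and [delta] *)

Lemma dTV_uniform_le (R : realType) (m M : nat) (S : {set 'I_M}) (eps delta : R) :
  (0 < m)%N -> #|S| = m -> 0 < delta -> 2 * delta <= eps -> eps < 2^-1 ->
  dTV (fun x => 2^-M * (1 + 0)) (Uprod S (delta / Num.sqrt m%:R)) <= eps.
Proof.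
move=> m0 Sm d0 de e2; set d := delta / _.
have mR : 0 < m%:R :> R by rewrite ltr0n.
have dm : d ^+ 2 * m%:R = delta ^+ 2.
  by rewrite /d expr_div_n sqr_sqrtr ?ler0n // divfK // gt_eqF.
have := dTV_avgE (fun=> 1 + 0) S d; rewrite /= => ->.
set A := avg _.
suff : A <= 2 * eps by lra.
(* The chi-square distance bounds the total variation; it is at most [expR (4 delta^2) - 1 <= 8
   delta^2 <= 2 eps^2]. *)
have A2 : A ^+ 2 <= (1 + 4 * d * d) ^+ m - 1.
  apply: le_trans (avg_sqr_le _) _.
  rewrite (eq_avg _ (fun x => 1 + (- 2 * tilt S d x + tilt S d x * tilt S d x))).
    by rewrite avgD avgD avgZ avg_cst avg_tilt avg_tilt2 finset.setIid Sm; lra.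
  by move=> x; rewrite real_normK ?num_real //; ring.
have y2 : (1 + 4 * d * d) ^+ m <= expR (4 * delta ^+ 2).
  rewrite (_ : 4 * delta ^+ 2 = m%:R * (4 * d * d)); last by rewrite -dm; ring.
  rewrite expRM_natl; apply: lerXn2r; rewrite ?nnegrE ?expR_ge0 ?expR_ge1Dx //.
  by rewrite -mulrA -expr2; have := sqr_ge0 d; lra.
have y3 : expR (4 * delta ^+ 2) <= 1 + 8 * delta ^+ 2.
  have h := expR_ge1Dx (- (4 * delta ^+ 2)); rewrite expRN in h.
  have E := expR_gt0 (4 * delta ^+ 2).
  have {}h : expR (4 * delta ^+ 2) * (1 - 4 * delta ^+ 2) <= 1.
    by rewrite -ler_pdivlMl // mulr1.
  have : 4 * delta ^+ 2 <= 4^-1 by nra.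
  nra.
have A0 : 0 <= A by rewrite -[leLHS](@avg_cst R M 0); apply: le_avg.
have B0 : 0 <= 2 * eps by lra.
have AB : A ^+ 2 <= (2 * eps) ^+ 2 by nra.
by move: AB; rewrite ler_pXn2r.
Qed.

Lemma exists_matched_family (R : realType) (m M k : nat) (eps delta : R) :
  (0 < m)%N -> (0 < k)%N -> 0 < eps < 2^-1 -> 0 < delta ->
  delta <= 1024^-1 * (eps * Num.sqrt (ln (1 / eps)) / k%:R ^+ 2) ->
  1 / eps <= m%:R ->
  exists f : {set 'I_M} -> cube M -> R,
    [/\ forall S : {set 'I_M}, #|S| = m -> is_pmf (fun x => 2^-M * (1 + f S x)),
        forall S : {set 'I_M}, #|S| = m -> dTV (fun x => 2^-M * (1 + f S x))
          (Uprod S (delta / Num.sqrt m%:R)) <= eps &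
        forall (S S' : {set 'I_M}) (rho : R), 0 <= rho <= 1 -> #|S :&: S'|%:R <= 64 * m%:R * rho ->
          `|avg (fun x => f S x * f S' x)| <= delta * rho ^+ k.+1].
Proof.
move=> m0 k0 /andP[e0 e2] d0 de em.
(* In the second case [delta > eps / 2], so the upper bound on [delta] forces
   [Num.sqrt (ln (1 / eps)) >= 512 k^2], which supplies the room in all estimates below. *)
have [small|big] := lerP (2 * delta) eps.
  exists (fun _ _ => 0); split.
  - move=> S _; have := unif_pmf R M.
    by congr is_pmf; apply/funext => x; rewrite /unif addr0 mulr1.
  - by move=> S Sm; apply: dTV_uniform_le.
  - move=> S S' rho /andP[r0 _] _.
    rewrite (eq_avg _ (fun=> 0)); last by move=> x; rewrite mulr0.
    by rewrite avg_cst normr0 mulr_ge0 ?exprn_ge0 // ltW.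
pose l := ln (1 / eps); pose y := Num.sqrt l.
have mR : 0 < m%:R :> R by rewrite ltr0n.
have kR : 1 <= k%:R :> R by rewrite ler1n.
have kk : 0 < k%:R ^+ 2 :> R by rewrite exprn_gt0 // ltr0n.
have l0 : 0 < l by rewrite ln_gt0 // ltr_pdivlMr // mul1r; lra.
have y0 : 0 < y by rewrite sqrtr_gt0.
have yl : y ^+ 2 = l by rewrite sqr_sqrtr // ltW.
have el : expR l = eps^-1 by rewrite lnK ?posrE ?divr_gt0 // div1r.
have de' : 1024 * delta * k%:R ^+ 2 <= eps * y.
  by move: de; rewrite -/l -/y mulrA ler_pdivlMr //; lra.
clear de.
have ky : 512 * k%:R ^+ 2 <= y by rewrite -(ler_pM2l e0); nra.
have lm : l <= m%:R.
  apply: le_trans em; rewrite /l.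
  have p : 0 < 1 / eps by rewrite divr_gt0.
  have h : -1 < 1 / eps - 1 by lra.
  by have := le_ln1Dx h; rewrite addrCA subrr addr0; lra.
pose K := if odd k then k else k.+1.
have oddK : odd K by rewrite /K; case: ifP => // /negbT /=.
have kK : (k <= K)%N by rewrite /K; case: ifP.
have K0 : 0 < K%:R :> R by rewrite ltr0n; apply: leq_trans kK.
have K2k : K%:R <= 2 * k%:R :> R.
  rewrite -natrM ler_nat /K mul2n -addnn; case: ifP => _; first exact: leq_addr.
  by rewrite -addn1 leq_add2l.
have KK : K%:R ^+ 2 <= 4 * k%:R ^+ 2 :> R by nra.
pose sm := Num.sqrt (m%:R : R).
have sm0 : 0 < sm by rewrite sqrtr_gt0.
have smm : sm ^+ 2 = m%:R by rewrite sqr_sqrtr // ler0n.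
(* [D] is chosen so that [256 m D^2 = l], and then [eta] so that [base_tilt] is [delta / sqrt m]. *)
pose D := y / 16 / sm.
pose eta := 16 * delta * K%:R ^+ 2 / y.
have D0 : 0 < D by rewrite !divr_gt0.
have D2 : 256 * m%:R * D ^+ 2 = l.
  by rewrite -smm -yl /D; field; rewrite gt_eqF.
have D4 : D <= 4^-1.
  have : D ^+ 2 <= 4^-1 ^+ 2.
    rewrite -(ler_pM2l (mulr_gt0 (ltr0Sn _ 255) mR)) D2; lra.
  by rewrite ler_pXn2r // nnegrE ?(ltW D0).
have eta0 : 0 < eta by rewrite divr_gt0 // mulr_gt0 ?exprn_gt0 // mulr_gt0.
have eta16 : eta <= eps / 16.
  rewrite /eta ler_pdivrMr //; nra.
clear de'.
have base_tiltE : base_tilt K D eta = delta / Num.sqrt m%:R.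
  by rewrite /base_tilt /D /eta -/sm; field; rewrite !gt_eqF.
(* Pays for [expR l = 1 / eps] in [matched_corr]: [eta <= delta / 8] and [eta <= eps / 16], and
   [81 <= 128]. *)
have etad : 81 * eta ^+ 2 * eps^-1 <= delta.
  have h1 : eta <= delta / 8.
    rewrite /eta ler_pdivrMr //.
    have := ler_wpM2l (ltW d0) KK; have := ler_wpM2l (ltW d0) ky; lra.
  rewrite ler_pdivrMr // expr2.
  have := ler_pM (ltW eta0) (ltW eta0) h1 eta16.
  by have := mulr_gt0 d0 e0; lra.
have etab : 0 < eta <= 4^-1 by rewrite eta0 /=; lra.
have Db : 0 < D <= 4^-1 by rewrite D0.
exists (matched K D eta (M := M)); split.
- move=> S Sm; apply: (@matched_pmf R K D eta oddK etab Db m l) => //.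
  + by rewrite expRN el invrK; lra.
  + by rewrite D2.
  + have k1 : 1 <= k%:R ^+ 2 :> R by rewrite exprn_ege1.
    have y1 : 1 <= y by lra.
    have : y <= y ^+ 2 by rewrite expr2 ler_peMl // ltW.
    by rewrite yl; lra.
- move=> S Sm; rewrite -base_tiltE.
  by apply: le_trans (dTV_matched oddK etab Db S) _; lra.
- move=> S S' rho rho01 nr; have /andP[rho0 rho1] := rho01.
  have h := matched_corr oddK etab Db rho01 (ltW l0) (S := S) (S' := S').
  apply: le_trans (h _) _.
    have nrD := ler_wpM2r (sqr_ge0 D) nr.
    apply: (@le_trans _ _ (4 * (64 * m%:R * rho * D ^+ 2))).
      by rewrite -mulrA ler_pM2l.
    by rewrite -D2 le_eqVlt; apply/orP; left; apply/eqP; ring.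
  rewrite el mulrAC; apply: ler_pM => //.
  + by rewrite mulr_ge0 ?invr_ge0 ?(ltW e0) // mulr_ge0 // sqr_ge0.
  + by rewrite exprn_ge0.
  + by rewrite ler_wiXn2l.
Qed.

(** * The lower bound *)

Lemma few_distinguished (R : realType) (M m r k : nat) (I : finType)
    (S : I -> {set 'I_M}) (f : {set 'I_M} -> cube M -> R)
    (p rho tau delta N : R) :
  0 < delta -> 0 < tau -> 0 <= rho <= 1 -> r%:R <= 64 * m%:R * rho ->
  delta * rho ^+ k.+1 <= tau -> 0 < N -> N * p * delta <= tau / 4 ->
  (forall i, #|S i| = m) ->
  (forall i, #|[pred j | (r <= #|S i :&: S j|)%N]|%:R <= p * #|I|%:R) ->
  (forall (S S' : {set 'I_M}) (rho : R), 0 <= rho <= 1 ->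
     #|S :&: S'|%:R <= 64 * m%:R * rho ->
     `|avg (fun x => f S x * f S' x)| <= delta * rho ^+ k.+1) ->
  forall g : cube M -> R, (forall x, -1 <= g x <= 1) ->
  #|[pred i | Num.sqrt (2 * tau) < `|avg (fun x => g x * f (S i) x)|]|%:R * N
    <= #|I|%:R / 4.
Proof.
move=> d0 t0 rho01 rm rt N0 Np cardS tail corr g gb.
(* Overlaps never exceed [m], so [rho = 1] applies to every pair. *)
have chi i j : `|avg (fun x => f (S i) x * f (S j) x)| <= delta.
  rewrite -[delta]mulr1 -[X in _ * X](expr1n _ k.+1); apply: corr.
    by rewrite ler01 lexx.
  have : #|S i :&: S j|%:R <= m%:R :> R.
    by rewrite ler_nat -(cardS i) subset_leq_card // finset.subsetIl.
  have := ler0n R m; lra.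
have small i j : ~~ (r <= #|S i :&: S j|)%N ->
    `|avg (fun x => f (S i) x * f (S j) x)| <= tau.
  rewrite -ltnNge => /ltnW lt; apply: le_trans rt; apply: corr => //.
  by apply: le_trans rm; rewrite ler_nat.
have t2 : 2 * tau <= Num.sqrt (2 * tau) ^+ 2.
  by rewrite sqr_sqrtr // mulr_ge0 // ltW.
have h := correlated_avg_le (bad := fun i j => (r <= #|S i :&: S j|)%N)
  (ltW d0) (ltW t0) (lexx tau) t2 (sqrtr_ge0 _) small chi tail gb.
rewrite -(ler_pM2r t0).
have h1 := ler_wpM2r (ltW N0) h.
have h2 := ler_wpM2l (ler0n R #|I|) Np.
lra.
Qed.

Lemma powR_le_expR (R : realType) (x : R) : 0 <= x -> 2 `^ x <= expR x.
Proof.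
move=> x0; rewrite /powR pnatr_eq0 /= ler_expR ler_piMr //.
have h : -1 < 1 :> R by lra.
exact: le_ln1Dx h.
Qed.

(* [Com] hides in the Omega, [Cerr] in the O(delta), [a] and [b] in the Theta.
   [Cerr < 1] cannot be dropped: the constant estimate (1/2, ..., 1/2) is at
   distance exactly delta from every mean vector. *)
Theorem theoremB4 (R : realType) :
  exists Com : R, 0 < Com /\
  forall c : R, 0 < c < 1 ->
  forall Cerr : R, 0 < Cerr < 1 ->
  forall a b : R, 0 < a -> a <= b ->
  exists (k0 : nat) (c0 C' : R), 0 < c0 /\ 0 < C' /\
  forall k : nat, (k0 <= k)%N ->
  forall m M : nat, (0 < m)%N -> (0 < M)%N ->
    M%:R = 3 * m%:R `^ (5 / 4) :> R ->
  forall eps : R, 0 < eps < 2^-1 ->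
  forall delta : R, 0 < delta ->
    delta <= c0 * (eps * Num.sqrt (ln (1 / eps)) / k%:R ^+ 2) ->
  forall tau : R,
    a * (M%:R `^ (- (k%:R + 1) / 5) * delta) <= tau ->
    tau <= b * (M%:R `^ (- (k%:R + 1) / 5) * delta) ->
  Num.max (C' / eps) (k%:R ^+ 2 / ln (1 / delta)) < m%:R ->
  forall (disp : measure_display) (W : measurableType disp)
    (Pr : probability W R) (A : W -> sq_alg R M),
  sq_estimates m eps (delta / Num.sqrt m%:R) (Cerr * delta) Pr A ->
  uses_tol_below m eps (delta / Num.sqrt m%:R) A (Num.sqrt (2 * tau)) \/
  uses_queries_at_least m eps (delta / Num.sqrt m%:R) A
    (2 `^ (Com * M%:R `^ (2 / 5)) * M%:R `^ (- (k%:R + 1) / 5)).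
Proof.
(* [M^(2/5) <= (3 q)^2] with [q = m^(1/4)], so the exponent of 2 is at most [q^2 / 2]. *)
exists 18^-1; split; first by rewrite invr_gt0.
move=> c _ C C01 a b a0 _.
have /andP[C0 C1] := C01.
have beta0 : 0 < 1 - C ^+ 2 by nra.
(* A lower bound for [m^(1/4)]: the first term serves [few_good_estimates], the second the bound on
   [X * p], and the last gives [1 <= q]. *)
pose Q0 : R := 24 / (1 - C ^+ 2) + 4 / a + 1.
have b24 : 0 < 24 / (1 - C ^+ 2) by rewrite divr_gt0.
have a4 : 0 < 4 / a by rewrite divr_gt0.
have Q1 : 1 <= Q0 by rewrite /Q0; lra.
have c0_gt0 : 0 < 1024^-1 :> R by rewrite invr_gt0 ltr0n.
(* [k >= k0 > 1 / a] makes [4 ^ (k + 1)] exceed [1 / a], absorbing the lower constant of the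
   Theta. *)
exists (Num.truncn a^-1).+1, 1024^-1, (Q0 ^+ 4).
split; first exact: c0_gt0.
split; first by rewrite exprn_gt0 //; lra.
move=> k kk0 m M m0 M0 ME eps e01 delta d0 de tau ta _ mbig disp W Pr A estA.
have /andP[e0 e2] := e01.
have mR : 0 < m%:R :> R by rewrite ltr0n.
have k0 : (0 < k)%N by apply: leq_ltn_trans kk0.
have Q4 : 1 <= Q0 ^+ 4 by rewrite exprn_ege1.
have mQ : Q0 ^+ 4 / eps < m%:R by move: mbig; rewrite gt_max => /andP[].
have mQ4 : Q0 ^+ 4 < m%:R.
  apply: le_lt_trans mQ; rewrite ler_pdivlMr // ler_piMr //; lra.
have em : 1 / eps <= m%:R.
  by apply: le_trans (ltW mQ); rewrite ler_pM2r ?invr_gt0.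
have [f [f_pmf f_tv f_corr]] := exists_matched_family M m0 k0 e01 d0 de em.
clear de c0_gt0.
(* The common scale: [m = q^4] and [M = 3 q^5]; there are at least [2 q] columns, and the overlap
   threshold [r] is between [4 q^3] and [5 q^3]. *)
pose q : R := Num.sqrt (Num.sqrt m%:R).
have q4 : q ^+ 4 = m%:R.
  by rewrite (exprM q 2 2) sqr_sqrtr ?sqrtr_ge0 // sqr_sqrtr // ltW.
have q0 : 0 < q by rewrite !sqrtr_gt0.
have qQ : Q0 <= q.
  rewrite leNgt; apply/negP => lt.
  have : q ^+ 4 <= Q0 ^+ 4.
    by apply: lerXn2r; rewrite ?nnegrE ?(ltW q0) ?(ltW lt) //; lra.
  by rewrite q4 leNgt mQ4.
have q1 : 1 <= q by lra.
have qa : 4 / a <= q by move: qQ; rewrite /Q0; lra.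
have qb : 24 / (1 - C ^+ 2) <= q by move: qQ; rewrite /Q0; lra.
clearbody q.
have ME5 : M%:R = 3 * q ^+ 5 :> R.
  rewrite ME -q4 -!powR_mulrn ?(ltW q0) // -powRrM.
  by congr (_ * _ `^ _); field.
have M3q : M%:R <= (3 * q) ^+ 5.
  have := exprn_gt0 5 q0; rewrite ME5 exprMn; lra.
have powM (x : R) : 0 <= x -> M%:R `^ x <= (3 * q) `^ (5 * x).
  move=> x0; rewrite powRrM; apply: ge0_ler_powR => //.
  - by rewrite nnegrE.
  - by rewrite nnegrE powR_ge0.
  by rewrite (powR_mulrn 5) // mulr_ge0 // ltW.
pose r := (Num.truncn (4 * q ^+ 3)).+1.
have q3 : 1 <= q ^+ 3 by rewrite exprn_ege1.
have r_ge : 4 * q ^+ 3 <= r%:R by apply: ltW; exact: truncnS_gt.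
have r_le : r%:R <= 5 * q ^+ 3.
  have : (Num.truncn (4 * q ^+ 3))%:R <= 4 * q ^+ 3 by rewrite truncn_le; lra.
  by rewrite /r -natr1; lra.
clearbody r.
pose bb := (M %/ m)%N.
have mbM : (m * bb <= M)%N by rewrite mulnC leq_trunc_div.
have bb_ge : 2 * q <= bb%:R.
  have : M%:R <= (bb%:R + 1) * m%:R :> R.
    by rewrite natr1 -natrM ler_nat ltnW // ltn_ceil.
  rewrite ME5 -q4 (exprSr q 4) => h.
  have {}h : 3 * q <= bb%:R + 1.
    by rewrite -(ler_pM2r (exprn_gt0 4 q0)); lra.
  by lra.
have rb : (6 * m <= r * bb)%N.
  rewrite -(ler_nat R) !natrM -q4.
  have : (4 * q ^+ 3) * (2 * q) <= r%:R * bb%:R.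
    by apply: ler_pM; rewrite // mulr_ge0 ?exprn_ge0 // ltW.
  have := exprn_gt0 4 q0; lra.
have bb0 : (0 < bb)%N by rewrite -(ltr_nat R); lra.
clearbody bb.
pose I : finType := {ffun 'I_m -> 'I_bb}.
pose S : I -> {set 'I_M} := graph_set mbM.
have cardS i : #|S i| = m by exact: card_graph_set.
pose p : R := 2^-r.
have p0 : 0 < p by rewrite invr_gt0 exprn_gt0.
have tail i : #|[pred j | (r <= #|S i :&: S j|)%N]|%:R <= p * #|I|%:R.
  exact: graph_set_overlap_tail.
have I0 : (0 < #|I|)%N by rewrite card_ffun !card_ord expn_gt0 bb0.
pose Mk := M%:R `^ (- (k%:R + 1) / 5) : R.
have Mk0 : 0 < Mk by rewrite powR_gt0 // ltr0n.
have tau0 : 0 < tau by apply: lt_le_trans ta; rewrite mulr_gt0 // mulr_gt0.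
have q3k : 0 < (3 * q) ^+ k.+1 by rewrite exprn_gt0 // mulr_gt0.
have Mk_ge : ((3 * q) ^+ k.+1)^-1 <= Mk.
  rewrite /Mk mulNr powRN lef_pV2 ?posrE ?powR_gt0 ?ltr0n //.
  apply: le_trans (powM _ _) _; first by rewrite divr_ge0 // addr_ge0.
  rewrite (_ : 5 * ((k%:R + 1) / 5) = k.+1%:R); last by rewrite -natr1; field.
  by rewrite powR_mulrn // mulr_ge0 // ltW.
(* Then [64 m rho = 16/3 q^3] exceeds [r], and [rho^(k+1)] is [4^-(k+1)], at most [a], times
   [(3 q)^-(k+1)], at most [Mk]. *)
pose rho : R := (12 * q)^-1.
have rho01 : 0 <= rho <= 1.
  rewrite invr_ge0 mulr_ge0 ?(ltW q0) //= invf_le1 ?mulr_gt0 //; lra.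
have r_rho : r%:R <= 64 * m%:R * rho.
  rewrite /rho -q4 (_ : 64 * q ^+ 4 / (12 * q) = 16 / 3 * q ^+ 3); first by lra.
  by field; rewrite gt_eqF.
have k_a : (4 ^+ k.+1)^-1 <= a.
  rewrite -[leRHS]invrK lef_pV2 ?posrE ?invr_gt0 ?exprn_gt0 //.
  apply: (@le_trans _ _ k.+1%:R).
    apply: ltW; apply: lt_le_trans (truncnS_gt _) _.
    by rewrite ler_nat; apply: leq_trans kk0 _.
  by rewrite -natrX ler_nat ltnW // ltn_expl.
have corr_tau : delta * rho ^+ k.+1 <= tau.
  apply: le_trans ta; rewrite mulrA [leRHS]mulrC ler_pM2l //.
  rewrite /rho (_ : 12 * q = 4 * (3 * q)); last by ring.
  rewrite exprVn exprMn invfM.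
  have q3k0 : 0 <= ((3 * q) ^+ k.+1)^-1 by rewrite invr_ge0 ltW.
  by apply: ler_pM k_a Mk_ge => //; rewrite invr_ge0 exprn_ge0.
pose X : R := 2 `^ (18^-1 * M%:R `^ (2 / 5)).
have X0 : 0 < X by rewrite powR_gt0.
(* The exponent [q^2 / 2 - r / 2] is at most [- q], and [expR (- q) <= 1 / (1 + q) <= a / 4]. *)
have Xp : X * p <= a / 4.
  have x_le : 18^-1 * M%:R `^ (2 / 5) <= 2^-1 * q ^+ 2.
    have := powM (2 / 5); rewrite (_ : 5 * (2 / 5) = 2%:R); last by field.
    rewrite powR_mulrn; last by rewrite mulr_ge0 // ltW.
    rewrite exprMn => /(_ _); lra.
  have X_le : X <= expR (2^-1 * q ^+ 2).
    apply: le_trans (powR_le_expR _) _; first by rewrite mulr_ge0 ?powR_ge0.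
    by rewrite ler_expR.
  have p_le : p <= expR (- (r%:R * 2^-1)).
    rewrite expRN lef_pV2 ?posrE ?expR_gt0 ?exprn_gt0 // expRM_natl.
    by apply: lerXn2r; rewrite ?nnegrE ?expR_ge0 ?expR_half_le2.
  apply: (le_trans (ler_pM (ltW X0) (ltW p0) X_le p_le)).
  rewrite -expRD; apply: (@le_trans _ _ (expR (- q))).
    rewrite ler_expR.
    have : q <= q ^+ 2 by rewrite expr2 ler_peMl // ltW.
    have : q ^+ 2 <= q ^+ 3 by rewrite [leRHS]exprS ler_peMl // exprn_ge0 // ltW.
    lra.
  rewrite expRN -[leRHS]invrK invf_div lef_pV2 ?posrE ?expR_gt0 //.
  by apply: (le_trans qa); apply: le_trans (expR_ge1Dx q); lra.
apply: (sq_lower_bound (I := I) (S := S) (f := fun i => f (S i)) I0 _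
  cardS (fun i => f_pmf _ (cardS i)) (fun i => f_tv _ (cardS i)) _ _ estA).
- by rewrite mulr_gt0.
- have Np : X * Mk * p * delta <= tau / 4.
    have Md : 0 <= Mk * delta by rewrite ltW // mulr_gt0.
    rewrite (_ : X * Mk * p * delta = X * p * (Mk * delta)); last by ring.
    apply: le_trans (ler_wpM2r Md Xp) _.
    by rewrite mulrAC ler_pM2r ?invr_gt0.
  apply: (few_distinguished d0 tau0 rho01 r_rho corr_tau _ Np cardS tail f_corr).
  by rewrite mulr_gt0.
- move=> v; apply: (few_good_estimates v m0 C01 d0 cardS tail).
  (* With [r <= 5 q^3] the left side is at most [6 q^3], whence the 24 in [Q0]. *)
  have pm : p * m%:R <= q ^+ 3.
    rewrite /p mulrC ler_pdivrMr ?exprn_gt0 // -q4 (exprSr q 3) ler_pM2l ?exprn_gt0 //.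
    apply: (@le_trans _ _ r%:R); last first.
      by rewrite -natrX ler_nat ltnW // ltn_expl.
    apply: le_trans r_ge.
    have : q <= q ^+ 3 by rewrite [leRHS]exprS ler_peMr ?(ltW q0) // exprn_ege1.
    lra.
  have bq : 24 <= (1 - C ^+ 2) * q by rewrite mulrC -ler_pdivrMr.
  have q30 : 0 <= q ^+ 3 by rewrite exprn_ge0 // ltW.
  by have := ler_wpM2r q30 bq; move: pm; rewrite -q4; lra.
Qed.
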